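(* Let $m$ be a positive integer such that any finite set of points in the plane can be colored with two colors so that any axis-aligned square containing at least $m$ of the points contains points of both colors. Then for every positive integer $k$, any finite set of points in the plane can be colored with $k$ colors so that any (open or closed) axis-aligned square containing at least $m_k=m\,(2m)^{\lceil \log_2 k\rceil-1}$ of the points contains points of all $k$ colors.
   Context: An axis-aligned square is a square region (of any positive side length) in $\mathbb R^2$ whose sides are parallel to the coordinate axes. Squares are closed unless stated otherwise. *)

(* Defs.v *)
From HB Require Import structures.
From mathcomp Require Import all_boot all_order all_algebra.
From mathcomp Require Import finmap boolp classical_sets set_interval reals.

Set Implicit Arguments.
Unset Strict Implicit.
Unset Printing Implicit Defensive.

Import Order.TTheory GRing.Theory Num.Theory.

Local Open Scope ring_scope.

Definition closed_square (R : realType) (Q : set (R * R)) : Prop :=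
  exists a b s : R, 0 < s /\ Q = (`[a, a + s] `*` `[b, b + s])%classic.

Definition open_square (R : realType) (Q : set (R * R)) : Prop :=
  exists a b s : R, 0 < s /\ Q = (`]a, a + s[ `*` `]b, b + s[)%classic.

(* The threshold [t] is a real number because the bound [m_bound] below need
   not be an integer. *)
Definition polychromatic (R : realType) (F : set (R * R) -> Prop) (t : R)
    (k : nat) (P : {fset R * R}) (c : P -> 'I_k) : Prop :=
  forall Q : set (R * R), F Q ->
    t <= #|` [fset p in P | p \in Q]%fset |%:R ->
    forall i : 'I_k, exists p : P, fsval p \in Q /\ c p = i.

(* For [0 < k], [up_log 2 k] is the ceiling of the base-2 logarithm of [k].
   The exponent is a relative integer: for [k = 1] it is -1 and the bound
   is 1/2. *)
Definition m_bound (R : realType) (m k : nat) : R :=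
  m%:R * (2 * m)%:R ^ ((up_log 2 k)%:Z - 1).

(* Main.v *)
Require Import Defs.
From mathcomp Require Import all_boot all_order all_algebra.
From mathcomp Require Import finmap boolp classical_sets set_interval reals.
From mathcomp Require Import zify lra.

(* Fix a 2-colouring in which every square with at least [m] points has both
   colours.  A square [Q] with [n] red points is a union of [2n+2] squares without
   red points in their interiors.  After a perturbation to general position these
   can be moved off the red points while keeping the other points, so each of them
   has fewer than [m] points; hence a square with [2mM] points has at least [M]
   points of either colour, and refining each colour class recursively doubles the
   number of colours at the cost of a factor [2m].

   The cover comes from a sweep line argument, as for Voronoi diagrams: a
   horizontal line moves up through [Q], and one keeps, from left to right, the
   sites lying on the boundary of a maximal square that has its top on the line
   and no red point in its interior.  Removing a site outputs one square, and each
   red point met by the line increases by at most two the number of sites plus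
   the number of output squares. *)

Set Implicit Arguments.
Unset Strict Implicit.
Unset Printing Implicit Defensive.

Import Order.TTheory GRing.Theory Num.Theory.

Local Open Scope ring_scope.

(** * Relations between consecutive terms of a list *)

Section Adjacent.

Variable T : Type.

Fixpoint adj (P : T -> T -> Prop) (l : seq T) : Prop :=
  if l is a :: ((b :: _) as l') then P a b /\ adj P l' else True.

Fixpoint adj3 (P : T -> T -> T -> Prop) (l : seq T) : Prop :=
  if l is a :: ((b :: c :: _) as l') then P a b c /\ adj3 P l' else True.

Lemma last_rev_head (x : T) l : last x (rev l) = head x l.
Proof. by case: l => // a l; rewrite rev_cons last_rcons. Qed.

Lemma adj_imp (P Q : T -> T -> Prop) l :
  (forall a b, P a b -> Q a b) -> adj P l -> adj Q l.
Proof.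
by move=> PQ; elim: l => // a [|b l] // IH [] /PQ ? /IH.
Qed.

Lemma adj3_imp (P Q : T -> T -> T -> Prop) l :
  (forall a b c, P a b c -> Q a b c) -> adj3 P l -> adj3 Q l.
Proof.
by move=> PQ; elim: l => // a [|b [|c l]] // IH [] /PQ ? /IH.
Qed.

Lemma adj_and (P Q : T -> T -> Prop) l :
  adj P l -> adj Q l -> adj (fun a b => P a b /\ Q a b) l.
Proof.
by elim: l => // a [|b l] // IH [? ?] [? ?]; split=> //; apply: IH.
Qed.

Lemma adj_cat (P : T -> T -> Prop) l1 x l2 :
  adj P (l1 ++ x :: l2) <-> adj P (rcons l1 x) /\ adj P (x :: l2).
Proof.
elim: l1 => [|a l1 IH]; first by split=> // -[].
case: l1 IH => [|b l1] IH; first by rewrite /=; tauto.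
rewrite !cat_cons rcons_cons in IH *.
split; first by move=> [? /IH[? ?]]; split=> //.
by move=> [[? ?] ?]; split=> //; apply/IH.
Qed.

Lemma adj_catl (P : T -> T -> Prop) l1 l2 : adj P (l1 ++ l2) -> adj P l1.
Proof. by elim: l1 => // a [|b l1] // IH [? /IH]. Qed.

Lemma adj_rev (P : T -> T -> Prop) l :
  adj P (rev l) <-> adj (fun a b => P b a) l.
Proof.
elim: l => // a [|b l] IH; first by [].
rewrite rev_cons rev_cons -cats1 cat_rcons adj_cat -rev_cons IH /=.
by split=> [[? []] //|[]].
Qed.

(** The triples of the concatenation that lie in neither piece have [x] in the middle. *)
Lemma adj3_glue (P : T -> T -> T -> Prop) l1 x l2 :
  (forall a b, P a x b) -> adj3 P (rcons l1 x) -> adj3 P (x :: l2) ->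
  adj3 P (l1 ++ x :: l2).
Proof.
move=> Px; elim: l1 => // a [|b [|c l1]] IH.
- by case: l2 IH => // b l2 _ _ ?; split.
- by move=> [? ?] ?; split=> //; apply: IH.
- by move=> [? ?] ?; split=> //; apply: IH.
Qed.

Lemma adj3_catr (P : T -> T -> T -> Prop) l1 l2 :
  adj3 P (l1 ++ l2) -> adj3 P l2.
Proof.
elim: l1 => // a l1 IH H; apply: IH; move: H => /=.
by case: (l1 ++ l2) => // b [|c l] //= [].
Qed.

Lemma adj3_catl (P : T -> T -> T -> Prop) l1 l2 :
  adj3 P (l1 ++ l2) -> adj3 P l1.
Proof.
by elim: l1 => // a [|b [|c l1]] // IH [? /IH].
Qed.

Lemma adj3_rcons (P : T -> T -> T -> Prop) l a b c :
  adj3 P (rcons (rcons l a) b) -> P a b c -> adj3 P (rcons (rcons (rcons l a) b) c).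
Proof.
by elim: l => [|x [|y [|z l]] IH] //= [? H] Pabc; split=> //; apply: IH.
Qed.

Lemma adj3_rev (P : T -> T -> T -> Prop) l :
  adj3 (fun a b c => P c b a) l -> adj3 P (rev l).
Proof.
elim: l => // a [|b [|c l]] // IH [Pabc /IH].
by rewrite !rev_cons => ?; apply: adj3_rcons.
Qed.

Lemma adj3_or (P : T -> T -> T -> Prop) l :
  (forall a b c, P a b c \/ ~ P a b c) ->
  adj3 P l \/ exists l1 a b c l2, l = l1 ++ [:: a, b, c & l2] /\ ~ P a b c.
Proof.
move=> P_em; elim: l => [|a l IH]; first by left.
case: IH => [IH|[l1 [b [c [d [l2 [-> nP]]]]]]]; last first.
  by right; exists (a :: l1), b, c, d, l2.
case: l IH => [|b [|c l]] IH; [by left|by left|].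
case: (P_em a b c) => [Pabc|nP]; first by left; split.
by right; exists [::], a, b, c, l.
Qed.

Lemma adj3_pair (P : T -> T -> Prop) l :
  adj P l -> adj3 (fun a b c => P a b /\ P b c) l.
Proof.
by elim: l => // a [|b [|c l]] // IH [? /[dup] H /IH]; split=> //; split=> //; case: H.
Qed.

Lemma adj3_and (P Q : T -> T -> T -> Prop) l :
  adj3 P l -> adj3 Q l -> adj3 (fun a b c => P a b c /\ Q a b c) l.
Proof.
by elim: l => // a [|b [|c l]] // IH [? ?] [? ?]; split=> //; apply: IH.
Qed.

Lemma adj3_remove (P : T -> T -> T -> Prop) l1 a b c l2 :
  (forall x, P x a b -> P x a c) -> (forall x, P b c x -> P a c x) ->
  adj3 P (l1 ++ [:: a, b, c & l2]) -> adj3 P (l1 ++ [:: a, c & l2]).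
Proof.
move=> P1 P2; elim: l1 => [|x l1 IH].
  by case: l2 => [|d l2] // [_ [/P2 ? ?]]; split=> //; case: l2 => [|? ?] in *.
by case: l1 IH => [|u [|v l1]] IH [Px H]; split; auto; apply: IH.
Qed.

End Adjacent.

(** * Covering a square by squares with empty interiors *)

(* The triple [K = (a, b, s)] stands for the square with lower left corner [(a, b)]
   and side [s]. *)
Definition in_sq (R : realFieldType) (K : R * R * R) (z : R * R) : bool :=
  [&& K.1.1 <= z.1, z.1 <= K.1.1 + K.2, K.1.2 <= z.2 & z.2 <= K.1.2 + K.2].

Definition in_int (R : realFieldType) (K : R * R * R) (z : R * R) : bool :=
  [&& K.1.1 < z.1, z.1 < K.1.1 + K.2, K.1.2 < z.2 & z.2 < K.1.2 + K.2].

Ltac tidy := repeat match goal with H : ?T |- _ =>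
  lazymatch type of T with
  | Prop => lazymatch T with
    | is_true (_ <= _) => fail
    | is_true (_ < _) => fail
    | @eq (prod _ _) _ _ => clear H
    | @eq (list _) _ _ => clear H
    | @eq nat _ _ => clear H
    | @eq _ _ _ => fail
    | _ => clear H
    end
  end end.

Ltac order_lra := tidy; lra.

(** * Sites, the columns between them and the empty squares they allow *)

Section Sweep.

Variables (R : realFieldType) (A B C D : R) (S : seq (R * R)).
Hypothesis ltAB : A < B.
Hypothesis sideE : D - C = B - A.
Hypothesis S_in : forall s, s \in S -> [/\ A < s.1, s.1 < B, C < s.2 & s.2 < D].
Hypothesis S_inj : {in S &, injective fst}.

Implicit Types (e : bool) (p q o s t z : R * R) (y : R) (dn l : seq (R * R)).
Implicit Types (out : seq (R * R * R)) (K : R * R * R).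

Definition good_sq K : Prop :=
  [/\ 0 < K.2, A <= K.1.1 /\ K.1.1 + K.2 <= B,
      C <= K.1.2 /\ K.1.2 + K.2 <= D & forall s, s \in S -> ~~ in_int K s].

Definition covered out z : bool := has (fun K => in_sq K z) out.

(* With [e = true] the plane is reflected, so that the two sides of a point are
   treated by the same lemmas. *)
Definition xo e p : R := if e then - p.1 else p.1.
Definition lo e : R := if e then - B else A.
Definition hi e : R := if e then - A else B.

Lemma square_exists e x b h :
  0 < h -> lo e <= x -> x + h <= hi e -> C <= b -> b + h <= D ->
  (forall s, s \in S -> x < xo e s -> xo e s < x + h -> b < s.2 -> s.2 < b + h ->
     False) ->
  exists2 K, good_sq K &
    forall z, in_sq K z = [&& x <= xo e z, xo e z <= x + h, b <= z.2 & z.2 <= b + h].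
Proof.
move=> h0 lx hx lb hb noS.
(* Reflection turns the interval from [x] to [x + h] into the one from [- (x + h)] to [- x]. *)
exists (if e then (- (x + h), b, h) else (x, b, h)).
- case: e lx hx noS => /= lx hx noS; split=> //=; try (split; order_lra).
  + move=> s /noS Hs; apply/negP=> /and4P[/= *]; apply: Hs => //; rewrite /xo; order_lra.
  + by move=> s /noS Hs; apply/negP=> /and4P[/= *]; apply: Hs => //; rewrite /xo.
- move=> z; case: e {lx hx noS}; rewrite /in_sq /xo //=.
  by apply/idP/idP => /and4P[*]; apply/and4P; split; order_lra.
Qed.

(* The strip between two consecutive sites [p] and [q] when the line is at height
   [y]: [dn] lists the points already met and [out] the squares already output.
   A site of height [C] stands for the bottom side of the big square; its abscissa
   is arbitrary. *)
Definition column e y dn out p q : Prop :=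
  [/\ xo e p < xo e q,
      forall s, s \in dn -> xo e p <= xo e s -> xo e s <= xo e q ->
        [\/ s = p, s = q
          | [/\ s.2 <= p.2, s.2 <= q.2 & s.2 <= y - (xo e q - xo e p)]],
      [\/ p.2 = C, q.2 = C | C <= y - (xo e q - xo e p)],
      forall z, xo e p <= xo e z -> xo e z <= xo e q -> C <= z.2 ->
        z.2 < p.2 -> z.2 < q.2 -> covered out z
    & C < p.2 \/ C < q.2].

(* When this fails for consecutive sites, the squares that rest on [p] and reach the
   line are blocked by [o] and [q]. *)
Definition wide e y o p q : Prop :=
  p.2 <= o.2 -> p.2 <= q.2 -> y - p.2 <= xo e q - xo e o.

(** The square in question has its top on the line, its bottom at the height of [q] and its left
    side (after reflection if [e = true]) at [p]. It fits into the big square and no met point is in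
    its interior. It is the square to output when [q] is removed. *)
Definition clear e y dn p q : Prop :=
  q.2 <= p.2 -> xo e p + (y - q.2) <= hi e /\
    forall s, s \in dn -> xo e p < xo e s -> xo e s < xo e p + (y - q.2) ->
      s.2 <= q.2.

(** This is what remains of [wide] at [q] once its left neighbour, at abscissa [x0], is known to be
    at least as high as [q]. *)
Definition next_far e y (x0 : R) q rest : Prop :=
  if rest is q' :: _ then q.2 <= q'.2 -> y - q.2 <= xo e q' - x0 else True.

(** The upper corners of the big square serve as permanent first and last sites, so a site on a
    vertical side may be above the line. *)
Definition site y dn r : Prop :=
  [/\ A <= r.1 /\ r.1 <= B, C <= r.2 /\ r.2 <= D, [\/ r.2 <= y, r.1 = A | r.1 = B]
    & r.1 = A \/ r.1 = B \/ r.2 = C \/ r \in dn].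

Lemma column_flip e y dn out p q :
  column e y dn out p q <-> column (~~ e) y dn out q p.
Proof.
have aux e' p' q' : column e' y dn out p' q' -> column (~~ e') y dn out q' p'.
  move=> [H1 H2 H3 H4 H5].
  have E u v : xo (~~ e') u - xo (~~ e') v = xo e' v - xo e' u.
    by rewrite /xo; case: e' {H1 H2 H3 H4} => /=; order_lra.
  have L u v : (xo (~~ e') u <= xo (~~ e') v) = (xo e' v <= xo e' u).
    by rewrite -subr_ge0 E subr_ge0.
  have L' u v : (xo (~~ e') u < xo (~~ e') v) = (xo e' v < xo e' u).
    by rewrite -subr_gt0 E subr_gt0.
  split; rewrite ?L' //.
  - move=> s /H2 Hs; rewrite !L => Hq Hp; rewrite E.
    by case: (Hs Hp Hq) => [->|->|[? ? ?]]; [constructor 2|constructor 1|constructor 3].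
  - by rewrite E; case: H3 => ?; [constructor 2|constructor 1|constructor 3].
  - by move=> z; rewrite !L => *; apply: H4.
  - by case: H5; [right|left].
by split=> [/aux//|/aux]; rewrite negbK.
Qed.

Lemma wide_flip e y o p q : wide e y o p q -> wide (~~ e) y q p o.
Proof. by rewrite /wide /xo => H h1 h2; move: (H h2 h1); case: e {H} => /=; order_lra. Qed.

Lemma covered_cat out1 out2 z : covered (out1 ++ out2) z = covered out1 z || covered out2 z.
Proof. exact: has_cat. Qed.

Lemma column_mono e y y' dn out out' p q : y <= y' ->
  (forall z, covered out z -> covered out' z) ->
  column e y dn out p q -> column e y' dn out' p q.
Proof.
move=> yy' oo' [H1 H2 H3 H4 H5]; split=> //.
- move=> s sd h1 h2; case: (H2 s sd h1 h2) => [->|->|[? ? ?]];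
    [constructor 1|constructor 2|constructor 3; split] => //; order_lra.
- by case: H3 => ?; [constructor 1|constructor 2|constructor 3; order_lra].
- by move=> z *; apply/oo'/H4.
Qed.

(* The square grows to the right of [x0] from the height of [q]; the sites met
   on the way are lower and lower, so that a [wide] local minimum stops it. *)
Lemma clear_suffix e y dn out rest q (x0 : R) :
  x0 <= xo e q ->
  adj (column e y dn out) (q :: rest) -> adj3 (wide e y) (q :: rest) ->
  (forall r, r \in q :: rest -> xo e r <= hi e) ->
  y <= (last q rest).2 -> xo e (last q rest) = hi e ->
  (forall s, s \in dn -> xo e s < hi e) ->
  next_far e y x0 q rest ->
  x0 + (y - q.2) <= hi e /\ forall s, s \in dn -> xo e q <= xo e s -> xo e s < x0 + (y - q.2) -> s.2 <= q.2.
Proof.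
elim: rest q x0 => [|q' rest IH] q x0 x0q /=.
  move=> _ _ _ yq qhi dnhi _; split; first order_lra.
  by move=> s /dnhi *; order_lra.
move=> [[H1 H2 _ _ _] Hadj] Hwide Hhi yl lhi dnhi Hx0.
have q'hi : xo e q' <= hi e by apply: Hhi; rewrite !inE eqxx orbT.
case: (leP q.2 q'.2) => [qq'|q'q].
  have {}Hx0 := Hx0 qq'; split; first order_lra.
  move=> s sd qs sx; have sq' : xo e s <= xo e q' by order_lra.
  by case: (H2 s sd qs sq') => [->|sE|[]] //; rewrite sE in sx; order_lra.
have Hw3 : next_far e y (xo e q) q' rest.
  by case: rest Hwide {IH Hhi Hadj yl lhi} => // q'' rest [Hw _] ?; apply: Hw => //; order_lra.
have Hw' : adj3 (wide e y) (q' :: rest) by case: rest Hwide {IH Hhi Hadj yl lhi Hw3} => // ? ? [].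
(* As [q'] is lower than [q], the square at the height of [q'] with left side at [q] reaches at
   least as far to the right, so the claim for it is the stronger one. *)
have [|] := IH q' (xo e q) (ltW H1) Hadj Hw' _ yl lhi dnhi Hw3.
  by move=> r rin; apply: Hhi; rewrite inE rin orbT.
move=> b1 b2; split; first order_lra.
move=> s sd qs sx; case: (leP (xo e s) (xo e q')) => [sq'|q's].
  by case: (H2 s sd qs sq') => [->|->|[]] //; order_lra.
by have := b2 s sd (ltW q's); order_lra.
Qed.

(** For each consecutive pair, [clear_suffix] applies with [x0] the abscissa of the left site. The
    last site, on the side of the big square and not below the line, stops every growing square. *)
Lemma clear_all e y dn out l r0 :
  adj (column e y dn out) l -> adj3 (wide e y) l ->
  (forall r, r \in l -> xo e r <= hi e) ->
  y <= (last r0 l).2 -> xo e (last r0 l) = hi e ->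
  (forall s, s \in dn -> xo e s < hi e) ->
  adj (clear e y dn) l.
Proof.
elim: l r0 => // o [|p l] IH r0 // Hadj Hw Hhi yl lhi dnhi.
split; last first.
  apply: (IH p) => //; first by case: Hadj.
    by case: l Hw {IH Hadj Hhi yl lhi} => // ? ? [].
  by move=> r rin; apply: Hhi; rewrite inE rin orbT.
move=> po; case: Hadj => [[H1 H2 _ _ _] Hadj].
have Hw' : adj3 (wide e y) (p :: l) by case: l Hw {IH Hadj Hhi yl lhi} => // ? ? [].
have Hw3 : next_far e y (xo e o) p l.
  by case: l Hw {IH Hadj Hhi yl lhi Hw'} => // q l [Hw _] ?; apply: Hw.
have [|b1 b2] := clear_suffix (ltW H1) Hadj Hw' _ yl lhi dnhi Hw3.
  by move=> r rin; apply: Hhi; rewrite inE rin orbT.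
split=> // s sd os sx; case: (leP (xo e s) (xo e p)) => [sp|ps].
  by case: (H2 s sd (ltW os) sp) => [sE|->|[]] //; rewrite sE in os; order_lra.
by apply: b2 => //; apply: ltW.
Qed.



(** * Output squares and removed sites on one side of a new point *)

Definition swept y dn : Prop := forall s, s \in S -> s \in dn \/ y <= s.2.

(** If the column is at least as wide as the part above [q] is high, the square spanning the column
    and hanging from the line works: [column] keeps the met points below it. Otherwise the square
    provided by [clear] works. *)
Lemma pair_square e y dn out p q :
  swept y dn -> y <= D -> C <= q.2 -> lo e <= xo e p -> xo e q <= hi e ->
  C <= y - (xo e q - xo e p) -> q.2 <= p.2 ->
  column e y dn out p q -> clear e y dn p q ->
  exists2 K, good_sq K & forall z, xo e p <= xo e z -> xo e z <= xo e q ->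
    q.2 <= z.2 -> z.2 <= y -> in_sq K z.
Proof.
move=> sw yD Cq lp qh Cy qp [H1 H2 _ _ _] /(_ qp)[cl1 cl2].
case: (leP (y - q.2) (xo e q - xo e p)) => hw.
- have [||||||K gK KE] := @square_exists e (xo e p) (y - (xo e q - xo e p)) (xo e q - xo e p); try order_lra.
    move=> s /sw[sd|ys] s1 s2 s3 s4; last order_lra.
    have [||sE|sE|[? ? ?]] := H2 s sd; first order_lra; first order_lra; try order_lra.
      by rewrite sE in s1; order_lra.
    by rewrite sE in s2; order_lra.
  by exists K => // z *; rewrite KE; apply/and4P; split; order_lra.
- have [||||||K gK KE] := @square_exists e (xo e p) q.2 (y - q.2); try order_lra.
    by move=> s /sw[sd|ys] s1 s2 s3 s4; [have := cl2 s sd s1 s2; order_lra|order_lra].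
  by exists K => // z *; rewrite KE; apply/and4P; split; order_lra.
Qed.

(** With [t] as new neighbour, [p] may cease to be [wide]. Then the square resting at the height of
    [p], with left side at the previous site [b] and top on the line, extends beyond [t]. It is good
    by [clear] and covers whatever the removal of [p] leaves uncovered, so one output square pays
    for one site. The test is then repeated with [b]. *)
Lemma pop_side e y dn out0 t l1 p out :
  swept y dn -> y <= D -> t.2 = y ->
  (forall z, covered out0 z -> covered out z) ->
  adj (fun b a => column e y dn out0 b a /\ clear e y dn b a) (rcons l1 p) ->
  adj3 (wide e y) (rcons l1 p) ->
  (forall r, r \in rcons l1 p -> lo e <= xo e r /\ C <= r.2) ->
  column e y (t :: dn) out p t ->
  exists l1' p' l2 out',
    [/\ rcons l1 p = rcons l1' p' ++ l2, size out' = size l2,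
        forall K, K \in out' -> good_sq K,
        column e y (t :: dn) (out' ++ out) p' t
      & adj3 (wide e y) (rcons (rcons l1' p') t)].
Proof.
move=> sw yD ty; elim/last_ind: l1 p out => [|l1 b IH] p out oo Hadj Hw Hr Hpt.
  by exists [::], p, [::], [::]; split.
case: (boolP [&& p.2 <= b.2, p.2 <= t.2 & xo e t - xo e b < y - p.2]); last first.
  move=> nar; exists (rcons l1 b), p, [::], [::]; split; rewrite ?cats0 //.
  apply: adj3_rcons => // pb pt; move: nar; rewrite pb pt /= -leNgt; order_lra.
move=> /and3P[pb pt nar].
have [Hadj' [[H1 H2 _ H4 _] /(_ pb)[cl1 cl2]]] : adj (fun b a => column e y dn out0 b a /\ clear e y dn b a) (rcons l1 b)
    /\ (column e y dn out0 b p /\ clear e y dn b p).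
  by move: Hadj; rewrite -cats1 cat_rcons adj_cat /= => -[? []].
have [lb Cb] := Hr b ltac:(by rewrite mem_rcons inE mem_rcons inE eqxx orbT).
have [_ Cp] := Hr p ltac:(by rewrite mem_rcons inE eqxx).
case: Hpt => [P1 P2 P3 P4 P5].
have [||||||K gK KE] := @square_exists e (xo e b) p.2 (y - p.2); try order_lra.
  by move=> s /sw[sd|ys] s1 s2 s3 s4; [have := cl2 s sd s1 s2; order_lra|order_lra].
have [||||l1' [p' [l2 [out' [E1 E2 E3 E4 E5]]]]] := IH b (K :: out) _ Hadj'.
- by move=> z /oo; rewrite /covered /= => ->; rewrite orbT.
- by move: Hw; rewrite -cats1; apply: adj3_catl.
- by move=> r rin; apply: Hr; rewrite mem_rcons inE rin orbT.
- split; first order_lra.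
  + move=> s; rewrite inE => /orP[/eqP->|sd] s1 s2; first by constructor 2.
    case: (leP (xo e s) (xo e p)) => sp.
      case: (H2 s sd s1 sp) => [->|->|[? ? ?]]; first by constructor 1.
        by constructor 3; split; order_lra.
      by constructor 3; split; order_lra.
    have sdt : s \in t :: dn by rewrite inE sd orbT.
    case: (P2 s sdt (ltW sp) s2) => [sE|->|[? ? ?]]; [by rewrite sE in sp; order_lra|by constructor 2|].
    by constructor 3; split; order_lra.
  + by constructor 3; order_lra.
  + move=> z z1 z2 z3 z4 z5; rewrite /covered /=; apply/orP.
    case: (ltP z.2 p.2) => zp; last by left; rewrite KE; apply/and4P; split; order_lra.
    right; case: (leP (xo e z) (xo e p)) => zp'; first by apply/oo/H4.
    by apply: P4 => //; order_lra.
  + by case: P5; order_lra.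
exists l1', p', (rcons l2 p), (rcons out' K); split=> //.
- by rewrite -rcons_cat -E1.
- by rewrite !size_rcons E2.
- by move=> K'; rewrite mem_rcons inE => /orP[/eqP->//|/E3].
- by rewrite cat_rcons.
Qed.

(** A removed site is exchanged for an output square, so [n] counts both together. The corner [r0]
    always survives. *)
Definition side_result e y dn out t (r0 : R * R) (n : nat) : Prop :=
  exists (lL : seq (R * R)) (outL : seq (R * R * R)),
    [/\ (size outL + size lL = n)%N /\ (exists l, lL = r0 :: l),
        forall K, K \in outL -> good_sq K,
        adj (column e y (t :: dn) (outL ++ out)) (rcons lL t),
        adj3 (wide e y) (rcons lL t)
      & forall r, r \in lL -> site y (t :: dn) r].

Lemma site_cons y dn t r : site y dn r -> site y (t :: dn) r.
Proof.
case=> ? ? ? H; split=> //; case: H => [?|[?|[?|?]]];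
  [left|right; left|do 2!right; left|do 3!right; rewrite inE; apply/orP; right]; done.
Qed.

Lemma adj_le_last e l p : adj (fun p q => xo e p < xo e q) (rcons l p) ->
  forall r, r \in rcons l p -> xo e r <= xo e p.
Proof.
elim: l => [|a [|b l] IH] /= H r; first by rewrite inE => /eqP->.
  by rewrite !inE => /orP[]/eqP->//; case: H => /ltW.
rewrite inE => /orP[/eqP->|]; last by apply: IH; case: H.
case: H => /ltW ab H; apply: le_trans ab _; apply: IH => //.
by rewrite inE eqxx.
Qed.

Lemma adj_imp_in (P Q : R * R -> R * R -> Prop) l :
  (forall a b, a \in l -> b \in l -> P a b -> Q a b) -> adj P l -> adj Q l.
Proof.
elim: l => // a [|b l] // IH PQ [Pab Hl]; split.
  by apply: PQ => //; rewrite !inE eqxx ?orbT.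
by apply: IH => // c d cl dl; apply: PQ; rewrite inE ?cl ?dl orbT.
Qed.

Lemma column_cons e y dn out out' p q t : xo e q < xo e t ->
  (forall z, covered out z -> covered out' z) ->
  column e y dn out p q -> column e y (t :: dn) out' p q.
Proof.
move=> qt oo' [H1 H2 H3 H4 H5]; split=> //; last by move=> z *; apply/oo'/H4.
move=> s; rewrite inE => /orP[/eqP->|/H2//] _.
by rewrite leNgt qt.
Qed.

Lemma lo_hi e r : lo e <= xo e r /\ xo e r <= hi e <-> A <= r.1 /\ r.1 <= B.
Proof. by rewrite /lo /hi /xo; case: e; split=> -[? ?]; split; order_lra. Qed.

Lemma covered_catr out' out z : covered out z -> covered (out' ++ out) z.
Proof. by rewrite covered_cat orbC => ->. Qed.

Lemma side_pop e y dn out0 t r0 l1 p out n :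
  swept y dn -> y <= D -> t.2 = y -> xo e p < xo e t ->
  (forall z, covered out0 z -> covered out z) ->
  adj (fun b a => column e y dn out0 b a /\ clear e y dn b a) (rcons l1 p) ->
  adj3 (wide e y) (rcons l1 p) ->
  (forall r, r \in rcons l1 p -> site y dn r) ->
  (exists l, rcons l1 p = r0 :: l) -> n = (size l1).+1 ->
  column e y (t :: dn) out p t ->
  side_result e y dn out t r0 n.
Proof.
move=> sw yD ty pt oo Hadj Hw Hs [l El] -> Hpt.
have Hr r : r \in rcons l1 p -> lo e <= xo e r /\ C <= r.2.
  by move=> /Hs[+ [? _] _ _] => /lo_hi -/(_ e)[].
have [l1' [p' [l2 [out' [E1 E2 E3 E4 E5]]]]] := pop_side sw yD ty oo Hadj Hw Hr Hpt.
have sub r : r \in rcons l1' p' -> r \in rcons l1 p.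
  by rewrite E1 mem_cat => ->.
exists (rcons l1' p'), out'; split=> //.
- split.
    by rewrite E2 -(size_rcons l1 p) E1 size_cat addnC.
  case: l1' E1 {E4 E5 sub} => [|b l1'] /=; rewrite El => -[-> _]; first by exists [::].
  by exists (rcons l1' p').
- rewrite -cats1 cat_rcons adj_cat; split; last by split.
  have Hadj' : adj (fun b a => column e y dn out0 b a /\ clear e y dn b a) (rcons l1' p').
    by move: Hadj; rewrite E1; apply: adj_catl.
  apply: adj_imp_in Hadj' => a b ain bin [Hab _].
  apply: column_cons Hab; last by move=> z /oo; apply: covered_catr.
  apply: le_lt_trans pt; apply: adj_le_last (sub _ bin).
  by apply: adj_imp Hadj => ? ? [[]].
- by move=> r /sub/Hs; apply: site_cons.
Qed.

(** Here [t] appears above the part of the bottom represented by [c]. If the column from [o] to [t]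
    is narrower than it is high, the square at the bottom with left side at [o] is output; otherwise
    a new bottom site is placed in the middle of the column. Either choice costs one unit beyond the
    sites up to [o]. *)
Lemma side_bottom e y dn out0 t r0 l1 o c q n :
  {subset dn <= S} ->
  swept y dn -> y <= D -> C < y -> t.2 = y -> xo e o < xo e t -> xo e t < xo e q -> c.2 = C ->
  adj (fun b a => column e y dn out0 b a /\ clear e y dn b a) (rcons (rcons (rcons l1 o) c) q) ->
  adj3 (wide e y) (rcons (rcons (rcons l1 o) c) q) ->
  (forall r, r \in rcons l1 o -> site y dn r) -> A <= t.1 -> t.1 <= B ->
  (exists l, rcons l1 o = r0 :: l) -> n = (size l1).+2 ->
  side_result e y dn out0 t r0 n.
Proof.
move=> dnS sw yD Cy ty ot tq cC Hadj Hw Hs tA tB [l El] nE.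
have El3 : rcons (rcons (rcons l1 o) c) q = l1 ++ [:: o; c; q].
  by rewrite -!cats1 -!catA.
have [Hadj' [[[O1 O2 O3 O4 O5] Ocl] [Q1 Q2 Q3 Q4 Q5]]] :
    adj (fun b a => column e y dn out0 b a /\ clear e y dn b a) (rcons l1 o) /\
    (column e y dn out0 o c /\ clear e y dn o c) /\ column e y dn out0 c q.
  by move: Hadj; rewrite El3 => /adj_cat[? [? [[? _] _]]].
have Hw' : adj3 (wide e y) (rcons l1 o).
  by move: Hw; rewrite El3 -cat_rcons; apply: adj3_catl.
have [[lo_t _] [hi_t _]] : (lo e <= xo e t /\ True) /\ (xo e t <= hi e /\ True).
  by have [] := (lo_hi e t).2 (conj tA tB).
have Hso : site y dn o by apply: Hs; rewrite mem_rcons inE eqxx.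
have Co : C <= o.2 by case: Hso => _ [].
have lo_o : lo e <= xo e o by case: Hso => /lo_hi -/(_ e)[].
(* Met points are strictly above [C], whereas a met point in a column next to [c], other than its
   two sites, would have to be at most as high as [c]. *)
have empty_col s : s \in dn -> xo e o <= xo e s -> xo e s <= xo e t -> s = o.
  move=> sd s1 s2; have [_ _ sC _] := S_in (dnS _ sd).
  case: (leP (xo e s) (xo e c)) => sc.
    by case: (O2 s sd s1 sc) => [//|sE|[? ? ?]]; exfalso; first rewrite sE in sC; order_lra.
  have sq : xo e s <= xo e q by order_lra.
  exfalso; case: (Q2 s sd (ltW sc) sq) => [sE|sE|[? ? ?]].
  - by rewrite sE in sC; order_lra.
  - by rewrite sE in s2; order_lra.
  - order_lra.
case: (ltP (xo e t - xo e o) (y - C)) => hit.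
- have [cl1 cl2] := Ocl ltac:(by rewrite cC); rewrite cC in cl1 cl2.
  have [||||||K gK KE] := @square_exists e (xo e o) C (y - C); try order_lra.
    by move=> s /sw[sd|ys] s1 s2 s3 s4; [have := cl2 s sd s1 s2; order_lra|order_lra].
  have Hot : column e y (t :: dn) (K :: out0) o t.
    split=> //.
    + move=> s; rewrite inE => /orP[/eqP->|sd] s1 s2; first by constructor 2.
      by constructor 1; apply: empty_col.
    + by constructor 3; order_lra.
    + move=> z *; rewrite /covered /= KE; apply/orP; left.
      by apply/and4P; split; order_lra.
    + by right; order_lra.
  have oo z : covered out0 z -> covered (K :: out0) z.
    by rewrite /covered /= => ->; rewrite orbT.
  have [|lL [outL [[E1 E2] E3 E4 E5 E6]]] :=
    @side_pop e y dn out0 t r0 l1 o (K :: out0) (size l1).+1 sw yD ty ot oo Hadj' Hw' Hs _ (erefl _) Hot.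
    by exists l.
  exists lL, (rcons outL K); split=> //.
  + by split=> //; rewrite size_rcons nE -E1.
  + by move=> K'; rewrite mem_rcons inE => /orP[/eqP->//|/E3].
  + by rewrite cat_rcons.
- pose c1 := if e then (- ((xo e o + xo e t) / 2), C) else ((xo e o + xo e t) / 2, C).
  have c1x : xo e c1 = (xo e o + xo e t) / 2.
    by rewrite /c1 /xo; case: (e) => /=; order_lra.
  have c1C : c1.2 = C by rewrite /c1; case: (e).
  have oC : C < o.2 by case: O5; order_lra.
  exists (rcons (rcons l1 o) c1), [::]; split=> //.
  + split; first by rewrite !size_rcons.
    by rewrite El; exists (rcons l c1).
  + rewrite -cats1 cat_rcons -cats1 -catA /= adj_cat; split; last first.
      have noz z : C <= z.2 -> z.2 < c1.2 -> covered out0 z by order_lra.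
      split; [split|split; last by []; split]; rewrite ?c1x ?c1C; try order_lra.
      * move=> s; rewrite inE => /orP[/eqP->|sd] s1 s2; first order_lra.
        by constructor 1; apply: empty_col => //; order_lra.
      * by constructor 2.
      * by move=> z *; apply: noz; rewrite ?c1C.
      * move=> s; rewrite inE => /orP[/eqP->|sd] s1 s2; first by constructor 2.
        by have sE := empty_col s sd ltac:(order_lra) s2; rewrite sE in s1; order_lra.
      * by constructor 1.
      * by move=> z *; apply: noz; rewrite ?c1C.
    apply: adj_imp_in (Hadj') => a b ain bin [Hab _].
    apply: column_cons Hab => //.
    apply: le_lt_trans ot; apply: adj_le_last bin.
    by apply: adj_imp Hadj' => ? ? [[]].
  + apply: adj3_rcons; last by rewrite /wide c1C; order_lra.
    case/lastP: (l1) Hw' => [//|l1' x] Hw'; apply: adj3_rcons => //.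
    by rewrite /wide c1C; order_lra.
  + move=> r; rewrite mem_rcons inE => /orP[/eqP->|/Hs/site_cons//].
    have [? ?] : A <= c1.1 /\ c1.1 <= B.
      by apply/(lo_hi e); rewrite c1x; order_lra.
    by split; [order_lra|rewrite c1C; order_lra|constructor 1; order_lra|right; right; left].
Qed.

(** While the line rises from [y0] to [y], the columns already refer to [y], but [wide] and [site]
    still refer to [y0]. The 3 counts the initial sites: two upper corners and one bottom site. *)
Definition state (y0 y : R) dn out l : Prop :=
  [/\ adj (column false y dn out) l, adj3 (wide false y0) l,
      forall r, r \in l -> site y0 dn r,
      (forall K, K \in out -> good_sq K) /\
        (size out + size l <= 2 * size dn + 3)%N
    & head (B, D) l = (A, D) /\ last (A, D) l = (B, D)].

Lemma wide_em e y o p q : wide e y o p q \/ ~ wide e y o p q.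
Proof.
rewrite /wide; case: (leP p.2 o.2); case: (leP p.2 q.2); case: (leP (y - p.2) (xo e q - xo e o));
  by [left|right=> /(_ isT isT)].
Qed.

(* A site [p] that stops being [wide] between the heights [y0] and [y] outputs the
   square that rests on [p] and fits exactly between its neighbours. *)
Lemma advance y0 y dn out l : state y0 y dn out l -> y0 <= y -> y <= D ->
  swept y dn -> exists l' out', state y y dn out' l'.
Proof.
move=> + y0y yD sw; have [n] := ubnP (size l); elim: n l out => // n IH l out.
move=> ln [Hadj Hw Hs [Hgood Hsz] [hdl lastl]].
case: (adj3_or l (wide_em false y)) => [Hw'|[l1 [o [p [q [l2 [El nw]]]]]]].
  exists l, out; split=> // r /Hs[? ? H ?]; split=> //.
  by case: H => ?; [constructor 1; order_lra|constructor 2|constructor 3].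
have [po [pq nar]] : p.2 <= o.2 /\ p.2 <= q.2 /\ q.1 - o.1 < y - p.2.
  move: nw; rewrite /wide /xo /=; case: (leP p.2 o.2); case: (leP p.2 q.2);
    case: (ltP (q.1 - o.1) (y - p.2)) => // *; exfalso; auto.
have lin r : r \in [:: o; p; q] -> r \in l.
  by rewrite El mem_cat !inE => /or3P[] /eqP->; rewrite eqxx ?orbT.
have [[oA oB] [oC oD] o3 _] := Hs o (lin o ltac:(by rewrite inE eqxx)).
have [[pA pB] [pC pD] _ _] := Hs p (lin p ltac:(by rewrite !inE eqxx orbT)).
have [[qA qB] [qC qD] q3 _] := Hs q (lin q ltac:(by rewrite !inE eqxx !orbT)).
move: (Hadj); rewrite El => /adj_cat[Hadj1 [Hop [Hpq Hadj2]]].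
move: (Hop) (Hpq) => [O1 O2 O3 O4 O5] [Q1 Q2 Q3 Q4 Q5].
rewrite /xo /= in O1 O2 O3 O4 Q1 Q2 Q3 Q4.
have wide0 : y0 - p.2 <= q.1 - o.1.
  by move: (Hw); rewrite El => /adj3_catr[+ _]; apply.
have [||||||K gK KE] := @square_exists false o.1 p.2 (q.1 - o.1); rewrite /xo /=; try order_lra.
  move=> s /sw[sd|ys] s1 s2 s3 s4; last order_lra.
  case: (leP s.1 p.1) => sp.
    case: (O2 s sd (ltW s1) sp) => [sE|sE|[? ? ?]]; last order_lra.
      by rewrite sE in s1; order_lra.
    by rewrite sE in s3; order_lra.
  have sq : s.1 <= q.1 by order_lra.
  case: (Q2 s sd (ltW sp) sq) => [sE|sE|[? ? ?]]; last order_lra.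
    by rewrite sE in s3; order_lra.
  by rewrite sE in s2; order_lra.
have [||l' [out' H]] := IH (l1 ++ [:: o, q & l2]) (K :: out).
- by move: ln; rewrite El !size_cat /=; clear; lia.
- split.
  + apply/adj_cat; split.
      apply: adj_imp Hadj1 => a b; apply: column_mono => // z.
      by rewrite /covered /= => ->; rewrite orbT.
    split; last first.
      apply: (@adj_imp _ (column false y dn out) _ (q :: l2)) Hadj2 => a b; apply: column_mono => // z.
      by rewrite /covered /= => ->; rewrite orbT.
    split; rewrite /xo /=; first order_lra.
    * move=> s sd s1 s2; case: (leP s.1 p.1) => sp.
        case: (O2 s sd s1 sp) => [->|->|[? ? ?]]; first by constructor 1.
          by constructor 3; split; order_lra.
        by constructor 3; split; order_lra.
      case: (Q2 s sd (ltW sp) s2) => [->|->|[? ? ?]]; last by constructor 3; split; order_lra.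
        by constructor 3; split; order_lra.
      by constructor 2.
    * by constructor 3; order_lra.
    * move=> z z1 z2 z3 z4 z5; rewrite /covered /=; apply/orP.
      case: (ltP z.2 p.2) => zp; [right|left].
        case: (leP z.1 p.1) => zp'; first by apply: O4.
        by apply: Q4 => //; order_lra.
      rewrite KE /xo /=.
      (* Were both [o] and [q] above [y0], they would be on opposite vertical sides, and [nar] would
         make the big square higher than wide. So the points to cover are below [y0], and by [wide0]
         the top of [K] is not. *)
      suff : o.2 <= y0 \/ q.2 <= y0 by case=> ?; apply/and4P; split; order_lra.
      case: o3 => o3; [by left| |exfalso; order_lra].
      case: q3 => q3; [by right|exfalso; order_lra|exfalso].
      have sideLe : D - C <= B - A by rewrite sideE.
      by order_lra.
    * by case: O5; case: Q5; order_lra.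
  (* Without [p], [wide] at [o] and at [q] follows from [wide0], because [o] and [q] are no lower
     than [p] and the new neighbours are even farther apart. Only the order of the abscissas has to
     be carried along. *)
  + have Hw2 : adj3 (fun a b c => wide false y0 a b c /\ (a.1 < b.1 /\ b.1 < c.1)) l.
      apply: adj3_and => //; apply: (@adj3_pair _ (fun a b => a.1 < b.1)).
      by apply: adj_imp Hadj => ? ? [].
    rewrite El in Hw2.
    suff : adj3 (fun a b c => wide false y0 a b c /\ (a.1 < b.1 /\ b.1 < c.1)) (l1 ++ [:: o, q & l2]).
      by apply: adj3_imp => ? ? ? [].
    apply: adj3_remove Hw2 => x; rewrite /wide /xo /= => -[_ [? ?]].
      by split=> *; order_lra.
    by split=> *; order_lra.
  + move=> r rin; apply: Hs; rewrite El; move: rin; rewrite !mem_cat !inE.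
    by case/orP=> [->//|/or3P[]->]; rewrite ?orbT.
  + split; last by move: Hsz; rewrite El !size_cat /=; clear; lia.
    by move=> K'; rewrite inE => /orP[/eqP->|/Hgood].
  + rewrite El in hdl lastl; split; first by case: (l1) hdl.
    by move: lastl; rewrite !last_cat.
by exists l', out'.
Qed.

(** In the column cut off at [t], the points below [p] must be covered even if they are above [q].
    The hypothesis on [out'] supplies them; it comes from one square covering the whole column above
    its lower site. *)
Lemma column_base e y dn out out' p q t :
  t.2 = y -> C < y -> C <= y - (xo e q - xo e p) ->
  xo e p < xo e t -> xo e t < xo e q ->
  (forall z, covered out z -> covered out' z) ->
  (forall z, xo e p <= xo e z -> xo e z <= xo e q -> p.2 <= z.2 \/ q.2 <= z.2 ->
     z.2 <= y -> covered out' z) ->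
  column e y dn out p q -> column e y (t :: dn) out' p t.
Proof.
move=> ty Cy Cw pt tq oo cov [H1 H2 _ H4 _]; split=> //.
- move=> s; rewrite inE => /orP[/eqP->|sd] s1 s2; first by constructor 2.
  have sq : xo e s <= xo e q by order_lra.
  case: (H2 s sd s1 sq) => [->|sE|[? ? ?]]; first by constructor 1.
    by exfalso; rewrite sE in s2; order_lra.
  by constructor 3; split; order_lra.
- by constructor 3; order_lra.
- move=> z z1 z2 z3 z4 z5; have zq : xo e z <= xo e q by order_lra.
  case: (ltP z.2 q.2) => zq'; first by apply/oo/H4.
  by apply: cov => //; [right|order_lra].
- by right; order_lra.
Qed.

Lemma side_combine y dn out1 t n1 n2 :
  t.2 = y -> site y (t :: dn) t ->
  side_result false y dn out1 t (A, D) n1 ->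
  side_result true y dn out1 t (B, D) n2 ->
  (forall K, K \in out1 -> good_sq K) ->
  (size out1 + n1 + n2 + 1 <= 2 * (size dn).+1 + 3)%N ->
  exists l' out', state y y (t :: dn) out' l'.
Proof.
move=> ty tsite [lL [oL [[sL [l1 hL]] gL aL wL siteL]]] [lR [oR [[sR [l2 hR]] gR aR wR siteR]]] g1 sz.
have Hadj : adj (column false y (t :: dn) (oL ++ oR ++ out1)) (lL ++ t :: rev lR).
  apply/adj_cat; split.
    apply: adj_imp aL => a b; apply: column_mono => // z.
    by rewrite !covered_cat => /orP[]->; rewrite ?orbT.
  rewrite -rev_rcons; apply/adj_rev; apply: adj_imp aR => a b /column_flip /=.
  by apply: column_mono => // z; rewrite [covered (oL ++ _) _]covered_cat => ->; rewrite orbT.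
exists (lL ++ t :: rev lR), (oL ++ oR ++ out1); split=> //.
- pose ord3 (a b c : R * R) := a.1 < b.1 /\ b.1 < c.1.
  have Hord : adj3 ord3 (lL ++ t :: rev lR).
    by apply: (@adj3_pair _ (fun a b => a.1 < b.1)); apply: adj_imp Hadj => ? ? [].
  have : adj3 (fun a b c => ord3 a b c -> wide false y a b c) (lL ++ t :: rev lR).
    apply: adj3_glue.
    (* The site [t] is on the line, so [wide] at [t] only asks for a nonnegative distance between
       its neighbours. *)
    + by move=> a b [? ?]; rewrite /wide ty /xo /=; order_lra.
    + by apply: adj3_imp wL.
    + rewrite -rev_rcons; apply: adj3_rev; apply: adj3_imp wR => a b c H _.
      exact: (wide_flip H).
  by move=> /(adj3_and Hord); apply: adj3_imp => a b c [? ]; apply.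
- move=> r; rewrite mem_cat inE mem_rev => /or3P[/siteL|/eqP->|/siteR] //.
- split; last first.
    rewrite !size_cat /= size_rev; move: sz; rewrite -sL -sR; clear; lia.
  by move=> K; rewrite !mem_cat => /or3P[/gL|/gR|/g1].
- by split; [rewrite hL|rewrite last_cat /= hR rev_cons last_rcons].
Qed.

Lemma state_clear e y dn out l : {subset dn <= S} -> y <= D -> state y y dn out l ->
  adj (fun b a => column e y dn out b a /\ clear e y dn b a) (if e then rev l else l).
Proof.
move=> dnS yD [Hadj Hw Hs _ [hdl lastl]].
have Hadj' : adj (column e y dn out) (if e then rev l else l).
  case: e => //=; apply/adj_rev; apply: adj_imp Hadj => a b.
  by move/column_flip.
apply: adj_and => //; apply: (clear_all (r0 := if e then (B, D) else (A, D)) Hadj').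
- case: e {Hadj'} => //; apply: adj3_rev; apply: adj3_imp Hw => a b c.
  exact: wide_flip.
- move=> r rin; have rl : r \in l by case: (e) rin; rewrite ?mem_rev.
  by have [/lo_hi -/(_ e)[]] := Hs r rl.
- by case: (e); rewrite ?last_rev_head ?hdl ?lastl.
- by case: (e); rewrite /xo /hi ?last_rev_head ?hdl ?lastl.
- by move=> s /dnS/S_in[? ? _ _]; rewrite /xo /hi; case: (e) => //; rewrite ltrN2.
Qed.

Lemma pair_square_sym y dn out p q :
  swept y dn -> y <= D -> C <= p.2 -> C <= q.2 -> A <= p.1 -> q.1 <= B ->
  C <= y - (q.1 - p.1) -> column false y dn out p q ->
  clear false y dn p q -> clear true y dn q p ->
  exists2 K, good_sq K & forall z, p.1 <= z.1 -> z.1 <= q.1 ->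
    p.2 <= z.2 \/ q.2 <= z.2 -> z.2 <= y -> in_sq K z.
Proof.
move=> sw yD Cp Cq pA qB Cw col cl1 cl2.
case: (leP q.2 p.2) => pq.
  have [//|//|//|K gK KE] := pair_square sw yD Cq _ _ _ pq col cl1.
  by exists K => // z ? ? H ?; apply: KE => //; case: H => //; order_lra.
move: col => /column_flip col.
have [|||K gK KE] := pair_square sw yD Cp _ _ _ (ltW pq) col cl2.
- by rewrite /lo /xo lerN2.
- by rewrite /hi /xo lerN2.
- by rewrite /xo /=; order_lra.
exists K => // z ? ? H ?; apply: KE; rewrite ?/xo ?lerN2 //.
by case: H => //; order_lra.
Qed.

(** If a neighbour of [t] is a bottom site, [side_bottom] replaces it on both sides of [t].
    Otherwise one square covering the column of [t] above its lower site is output, and [side_pop]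
    treats each side. Counting [t], both cases add two to the number of sites and squares. *)
Lemma insert_point y dn out l t : {subset dn <= S} -> t \in S -> t \notin dn ->
  t.2 = y -> swept y dn -> state y y dn out l ->
  exists l' out', state y y (t :: dn) out' l'.
Proof.
move=> dnS tS tdn ty sw [Hadj Hw Hs [Hgood Hsz] [hdl lastl]].
have [tA tB tC tD] := S_in tS.
have yD : y <= D by rewrite -ty ltW.
have Cy : C < y by rewrite -ty.
have CD : C < D by apply: lt_trans tC tD.
have tsite : site y (t :: dn) t.
  by split; [split; exact: ltW|rewrite ty; split=> //; exact: ltW|
    constructor 1; rewrite ty|do 3!right; rewrite inE eqxx].
pose L e := if e then rev l else l.
have wideL e : adj3 (wide e y) (L e).
  case: e => //=; apply: adj3_rev; apply: adj3_imp Hw => a b c; exact: wide_flip.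
have siteL e r : r \in L e -> site y dn r.
  by case: e => /=; rewrite ?mem_rev; apply: Hs.
have HL e : adj (fun b a => column e y dn out b a /\ clear e y dn b a) (L e).
  by apply: state_clear.
have [l1 [p [q [l2 [El pt tq]]]]] : exists l1 p q l2,
    [/\ l = l1 ++ [:: p, q & l2], p.1 <= t.1 & t.1 < q.1].
  have : (head (B, D) l).1 <= t.1 by rewrite hdl ltW.
  have : t.1 < (last (A, D) l).1 by rewrite lastl.
  have : l <> [::] by move=> l0; move: hdl; rewrite l0 => -[] BA; move: ltAB; rewrite BA ltxx.
  case: (l) => // a l' _ /=; elim: l' a => [|b l' IH] a /= H1 H2.
    by exfalso; order_lra.
  case: (leP b.1 t.1) => bt; last by exists [::], a, b, l'.
  have [l1 [p [q [l2 [-> ? ?]]]]] := IH b H1 bt.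
  by exists (a :: l1), p, q, l2.
have bottom m1 o c r m2 : l = m1 ++ [:: o, c, r & m2] -> c.2 = C -> o.1 < t.1 -> t.1 < r.1 ->
    exists l' out', state y y (t :: dn) out' l'.
  move=> Em cC ot tr.
  have El0 : L false = rcons (rcons (rcons m1 o) c) r ++ m2.
    by rewrite /L Em -!cats1 -!catA.
  have El1 : L true = rcons (rcons (rcons (rev m2) r) c) o ++ rev m1.
    by rewrite /L Em rev_cat !rev_cons -!cats1 -!catA.
  have s0 : side_result false y dn out t (A, D) (size m1).+2.
    apply: (@side_bottom false y dn out t (A, D) m1 o c r) => //.
    - by move: (HL false); rewrite El0; apply: adj_catl.
    - by move: (wideL false); rewrite El0; apply: adj3_catl.
    - move=> u uin; apply: (siteL false); rewrite El0 mem_cat mem_rcons inE.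
      by rewrite [u \in rcons (rcons _ _) _]mem_rcons inE uin !orbT.
    - exact: ltW.
    - exact: ltW.
    - move: hdl; rewrite Em; case: (m1) => [|a m] /= ->; first by exists [::].
      by exists (rcons m o).
  have s1 : side_result true y dn out t (B, D) (size m2).+2.
    apply: (@side_bottom true y dn out t (B, D) (rev m2) r c o) => //.
    - by rewrite /xo ltrN2.
    - by rewrite /xo ltrN2.
    - by move: (HL true); rewrite El1; apply: adj_catl.
    - by move: (wideL true); rewrite El1; apply: adj3_catl.
    - move=> u uin; apply: (siteL true); rewrite El1 mem_cat mem_rcons inE.
      by rewrite [u \in rcons (rcons _ _) _]mem_rcons inE uin !orbT.
    - exact: ltW.
    - exact: ltW.
    - move: lastl; rewrite Em last_cat /=; case/lastP: (m2) => [|m a] /=.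
        by move=> ->; exists [::].
      by rewrite last_rcons => ->; exists (rcons (rev m) r); rewrite rev_rcons.
    - by rewrite size_rev.
  apply: (side_combine ty tsite s0 s1 Hgood).
  by move: Hsz; rewrite Em !size_cat /=; clear; lia.
have pin : p \in l by rewrite El mem_cat !inE eqxx orbT.
have qin : q \in l by rewrite El mem_cat !inE eqxx !orbT.
case: (eqVneq p.2 C) => [pC|pC].
  case/lastP: l1 El => [|l1 o] El.
    by move: hdl; rewrite El /= => pE; move: pC CD; rewrite pE /= => ->; rewrite ltxx.
  apply: (bottom l1 o p q l2) => //; first by rewrite El cat_rcons.
  apply: lt_le_trans pt; move: Hadj; rewrite El cat_rcons adj_cat => -[_ [[+ _ _ _ _] _]].
  by [].
have pt' : p.1 < t.1.
  rewrite lt_neqAle pt andbT; apply/eqP => ptE.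
  have [_ _ _ []] := Hs p pin; first by order_lra.
  case; first by order_lra.
  case=> [pC'|pd]; first by rewrite pC' eqxx in pC.
  have pE := S_inj (dnS _ pd) tS ptE.
  by rewrite -pE pd in tdn.
case: (eqVneq q.2 C) => [qC|qC].
  case: l2 El => [|r l2] El.
    by move: lastl; rewrite El last_cat /= => qE; move: qC CD; rewrite qE /= => ->; rewrite ltxx.
  apply: (bottom l1 p q r l2) => //.
  apply: lt_trans tq _; move: Hadj; rewrite El adj_cat => -[_ [_ [[+ _ _ _ _] _]]].
  by [].
have [Hpq1 Hpq2] : (column false y dn out p q /\ clear false y dn p q) /\
                   (column true y dn out q p /\ clear true y dn q p).
  split; first by move: (HL false); rewrite /L El adj_cat => -[_ []].
  move: (HL true); rewrite /L El rev_cat !rev_cons cat_rcons cat_rcons.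
  by rewrite adj_cat => -[_ []].
have [[pA pB] [pC1 pD] _ _] := Hs p pin.
have [[qA qB] [qC1 qD] _ _] := Hs q qin.
have Cw : C <= y - (q.1 - p.1).
  by case: Hpq1 => -[_ _ + _ _] _; case=> // E; rewrite E eqxx in pC qC.
have [K gK KE] : exists2 K, good_sq K & forall z, p.1 <= z.1 -> z.1 <= q.1 ->
    p.2 <= z.2 \/ q.2 <= z.2 -> z.2 <= y -> in_sq K z.
  by apply: (pair_square_sym sw yD pC1 qC1 pA qB Cw Hpq1.1 Hpq1.2 Hpq2.2).
have cov e z : xo e (if e then q else p) <= xo e z -> xo e z <= xo e (if e then p else q) ->
    p.2 <= z.2 \/ q.2 <= z.2 -> z.2 <= y -> covered (K :: out) z.
  case: e; rewrite /xo ?lerN2 => ? ? ? ?; rewrite /covered /= KE //.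
have oo z : covered out z -> covered (K :: out) z.
  by rewrite /covered /= => ->; rewrite orbT.
have El0 : L false = rcons l1 p ++ q :: l2 by rewrite /L El cat_rcons.
have El1 : L true = rcons (rev l2) q ++ p :: rev l1.
  by rewrite /L El rev_cat !rev_cons -!cats1 -!catA.
have s0 : side_result false y dn (K :: out) t (A, D) (size l1).+1.
  apply: (@side_pop false y dn out t (A, D) l1 p) => //.
  - by move: (HL false); rewrite El0; apply: adj_catl.
  - by move: (wideL false); rewrite El0; apply: adj3_catl.
  - by move=> u uin; apply: (siteL false); rewrite El0 mem_cat uin.
  - move: hdl; rewrite El; case: (l1) => [|a m] /= ->; first by exists [::].
    by exists (rcons m p).
  - exact: (@column_base false y dn out (K :: out) p q t ty Cy Cw pt' tq oo (cov false) Hpq1.1).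
have s1 : side_result true y dn (K :: out) t (B, D) (size l2).+1.
  apply: (@side_pop true y dn out t (B, D) (rev l2) q) => //.
  - by rewrite /xo ltrN2.
  - by move: (HL true); rewrite El1; apply: adj_catl.
  - by move: (wideL true); rewrite El1; apply: adj3_catl.
  - by move=> u uin; apply: (siteL true); rewrite El1 mem_cat uin.
  - move: lastl; rewrite El last_cat /=; case/lastP: (l2) => [|m a] /=.
      by move=> ->; exists [::].
    by rewrite last_rcons => ->; exists (rcons (rev m) q); rewrite rev_rcons.
  - by rewrite size_rev.
  - apply: (@column_base true y dn out (K :: out) q p t ty Cy _ _ _ oo _ Hpq2.1).
    + by rewrite /xo; order_lra.
    + by rewrite /xo ltrN2.
    + by rewrite /xo ltrN2.
    + by move=> z z1 z2 z3; apply: (cov true) => //; case: z3; [right|left].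
apply: (side_combine ty tsite s0 s1).
  by move=> K'; rewrite inE => /orP[/eqP->|/Hgood].
by move: Hsz; rewrite El !size_cat /=; clear; lia.
Qed.

(** With the line at the top, one more square per column covers what is left of it. There is one
    column less than there are sites, whence 2 instead of 3. Chaining the columns leaves out the
    abscissa [A]. *)
Lemma finish dn out l : {subset dn <= S} -> swept D dn -> state D D dn out l ->
  exists outs, [/\ (size outs <= 2 * size dn + 2)%N, forall K, K \in outs -> good_sq K
    & forall z, A < z.1 -> z.1 <= B -> C <= z.2 -> z.2 <= D -> covered outs z].
Proof.
move=> dnS sw st; have [_ _ Hs [Hgood Hsz] [hdl lastl]] := st.
pose G (p q : R * R) := exists2 K, good_sq K &
  forall z, p.1 <= z.1 -> z.1 <= q.1 -> C <= z.2 -> z.2 <= D ->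
    covered out z \/ in_sq K z.
have HG : adj G l.
  have H1 := state_clear false dnS (lexx D) st.
  have /adj_rev H2 := state_clear true dnS (lexx D) st.
  have H := adj_and H1 H2; apply: adj_imp_in H => p q pl ql [[col cl1] [_ cl2]].
  have [[pA _] [Cp _] _ _] := Hs p pl; have [[_ qB] [Cq _] _ _] := Hs q ql.
  have [|K gK KE] := pair_square_sym sw (lexx D) Cp Cq pA qB _ col cl1 cl2.
    have sideLe : B - A <= D - C by rewrite sideE.
    by order_lra.
  exists K => // z z1 z2 z3 z4.
  case: (ltP z.2 p.2) => zp; last by right; apply: KE => //; left.
  case: (ltP z.2 q.2) => zq; last by right; apply: KE => //; right.
  by left; case: col => _ _ _ H _; apply: H.
have [outs [szo go co]] : exists outs, [/\ size outs = (size l).-1,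
    forall K, K \in outs -> good_sq K &
    forall z, A < z.1 -> z.1 <= B -> C <= z.2 -> z.2 <= D ->
      covered out z \/ covered outs z].
  have -> : A = (head (B, D) l).1 by rewrite hdl.
  have -> : B = (last (A, D) l).1 by rewrite lastl.
  case: (l) HG => [_|a l'] /=.
    by exists [::]; split=> // z *; exfalso; order_lra.
  elim: l' a => [|b l' IH] a; first by exists [::]; split=> // z *; exfalso; order_lra.
  move=> [[K gK KE] /IH[outs [so go co]]]; exists (K :: outs); split=> //.
  - by rewrite /= so.
  - by move=> K'; rewrite inE => /orP[/eqP->|/go].
  move=> z z1 z2 z3 z4; case: (leP z.1 b.1) => zb.
    by case: (KE z (ltW z1) zb z3 z4) => H; [left|right; rewrite /covered /= H].
  by case: (co z zb z2 z3 z4) => H; [left|right; move: H; rewrite /covered /= => ->; rewrite orbT].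
exists (outs ++ out); split.
- rewrite size_cat szo; case: (l) hdl Hsz => [|a l'] /=.
    by move=> -[BA]; move: ltAB; rewrite BA ltxx.
  by move=> _; clear; lia.
- by move=> K; rewrite mem_cat => /orP[/go|/Hgood].
- by move=> z z1 z2 z3 z4; rewrite covered_cat; have [->|->] := co z z1 z2 z3 z4; rewrite ?orbT.
Qed.

(** * The complete sweep and the resulting cover *)

Lemma state_mono y0 y y' dn out l : y <= y' -> state y0 y dn out l -> state y0 y' dn out l.
Proof.
move=> yy' [Hadj Hw Hs Hg Hl]; split=> //.
by apply: adj_imp Hadj => a b; apply: column_mono.
Qed.

(** Each step is an [advance] to the height of the next point followed by [insert_point]. Points of
    equal height are inserted one after the other with the line at rest. *)
Lemma sweep rem dn y out l : {subset dn <= S} -> {subset rem <= S} -> uniq (dn ++ rem) ->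
  (forall s, s \in S -> s \in dn \/ s \in rem) ->
  sorted (fun s t => s.2 <= t.2) rem -> (forall s, s \in rem -> y <= s.2) -> y <= D ->
  state y y dn out l ->
  exists outs, [/\ (size outs <= 2 * (size dn + size rem) + 2)%N,
    forall K, K \in outs -> good_sq K
    & forall z, A < z.1 -> z.1 <= B -> C <= z.2 -> z.2 <= D -> covered outs z].
Proof.
elim: rem dn y out l => [|t rem IH] dn y out l dnS remS un cov srt yrem yD st.
  have sw : swept D dn by move=> s /cov[]// sd; left.
  have [l' [out' st']] := advance (state_mono yD st) yD (lexx D) sw.
  by rewrite addn0; apply: (finish dnS sw st').
have tS : t \in S by apply: remS; rewrite inE eqxx.
have tD : t.2 <= D by case: (S_in tS) => _ _ _ /ltW.
have trem s : s \in rem -> t.2 <= s.2.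
  move: srt; rewrite /= path_sortedE; first by case/andP => /allP H _; apply: H.
  by move=> a b c; apply: le_trans.
have sw : swept t.2 dn.
  move=> s /cov[sd|]; first by left.
  by rewrite inE => /orP[/eqP->|/trem]; right.
have yt : y <= t.2 by apply: yrem; rewrite inE eqxx.
have [l1 [out1 st1]] := advance (state_mono yt st) yt tD sw.
have tdn : t \notin dn.
  by move: un; rewrite cat_uniq /= => /and3P[_ /norP[]].
have [l2 [out2 st2]] := insert_point dnS tS tdn (erefl _) sw st1.
have [|||||outs [H1 H2 H3]] := IH (t :: dn) t.2 out2 l2 _ _ _ _ _ trem tD st2.
- by move=> s; rewrite inE => /orP[/eqP->|/dnS].
- by move=> s sr; apply: remS; rewrite inE sr orbT.
- by move: un; rewrite -cat1s uniq_catCA.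
- move=> s /cov[sd|]; first by left; rewrite inE sd orbT.
  by rewrite inE => /orP[/eqP->|]; [left; rewrite inE eqxx|right].
- by move: srt => /= /path_sorted.
by exists outs; split=> //; move: H1 => /=; rewrite addSnnS.
Qed.

Lemma square_cover : uniq S ->
  exists outs, [/\ (size outs <= 2 * size S + 2)%N, forall K, K \in outs -> good_sq K
    & forall z, A < z.1 -> z.1 <= B -> C <= z.2 -> z.2 <= D -> covered outs z].
Proof.
move=> unS.
have CD : C < D by rewrite -subr_gt0 sideE subr_gt0.
pose c := ((A + B) / 2, C).
have st : state C C [::] [::] [:: (A, D); c; (B, D)].
  have [cA cB] : A < c.1 /\ c.1 < B by rewrite /c /=; split; case: (midf_lt ltAB).
  split=> //=.
  - have noz (v : R) : C <= v -> v < C -> false by move=> Cv /lt_geF<-.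
    by split; [|split; last by []]; rewrite /column /xo /=; split=> //;
      first [by constructor 2 | by constructor 1 | by right | by move=> z *; apply: (noz z.2)].
  - by rewrite /wide /xo /c /=; split=> // *; order_lra.
  - move=> r; rewrite !inE => /or3P[]/eqP->; rewrite /c; split=> //=; try (split; order_lra).
    + by constructor 2.
    + by left.
    + by constructor 1.
    + by right; right; left.
    + by constructor 3.
    + by right; left.
pose S' := sort (fun s t : R * R => s.2 <= t.2) S.
have [|||||||outs [H1 H2 H3]] := @sweep S' [::] C [::] _ _ _ _ _ _ _ _ st => //.
- by move=> s; rewrite mem_sort.
- by rewrite /= sort_uniq.
- by move=> s sS; right; rewrite mem_sort.
- by apply: sort_sorted => a b; apply: le_total.
- by move=> s; rewrite mem_sort => /S_in[_ _ /ltW].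
- exact: ltW.
by exists outs; split=> //; move: H1; rewrite add0n size_sort.
Qed.

End Sweep.

(** * Points in general position *)

Section Small.

Variable R : realFieldType.

Definition small (P : R -> Prop) : Prop :=
  exists2 e0, 0 < e0 & forall e, 0 < e -> e < e0 -> P e.

Lemma small_ex P : small P -> exists2 e, 0 < e & P e.
Proof.
case=> e0 e0_gt0 Pe; exists (e0 / 2); first by rewrite divr_gt0.
by apply: Pe; [rewrite divr_gt0|rewrite ltr_pdivrMr // ltr_pMr // ltr1n].
Qed.

Lemma small_imp (P Q : R -> Prop) :
  (forall e, 0 < e -> P e -> Q e) -> small P -> small Q.
Proof. by move=> PQ [e0 e0_gt0 Pe]; exists e0 => // e *; apply: PQ => //; apply: Pe. Qed.

Lemma small_and (P Q : R -> Prop) :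
  small P -> small Q -> small (fun e => P e /\ Q e).
Proof.
move=> [e1 e1_gt0 Pe] [e2 e2_gt0 Qe]; exists (Num.min e1 e2).
  by rewrite lt_min e1_gt0.
by move=> e e_gt0; rewrite lt_min => /andP[? ?]; split; [apply: Pe|apply: Qe].
Qed.

Lemma small_lt (d : R) : 0 < d -> small (fun e => e < d).
Proof. by exists d. Qed.

Lemma small_true P : (forall e, P e) -> small P.
Proof. by exists 1. Qed.

Lemma small_all (T : eqType) (s : seq T) (P : T -> R -> Prop) :
  (forall x, x \in s -> small (P x)) -> small (fun e => forall x, x \in s -> P x e).
Proof.
elim: s => [|a s IH] Ps; first exact: small_true.
have [||e0 e0_gt0 He] := @small_and (P a) (fun e => forall x, x \in s -> P x e).
- by apply: Ps; rewrite inE eqxx.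
- by apply: IH => x xs; apply: Ps; rewrite inE xs orbT.
exists e0 => // e e_gt0 ee0 x; have [Pa Pse] := He e e_gt0 ee0.
by rewrite inE => /orP[/eqP->|/Pse].
Qed.

(** Factors ['X] do not vanish at positive [e]. Once the constant term [c] is nonzero it dominates
    the other terms, which are at most [M * e] on the unit interval. *)
Lemma small_poly (p : {poly R}) : p != 0 -> small (fun e => p.[e] != 0).
Proof.
elim/poly_ind: p => [|p c IH]; first by rewrite eqxx.
have [->|c0 _] := eqVneq c 0.
  rewrite addr0 mulf_eq0 polyX_eq0 orbF => /IH; apply: small_imp => e e_gt0 pe.
  by rewrite hornerM hornerX mulf_neq0 // gt_eqF.
have [M HM] := poly_itv_bound p 0 1.
have M0 : 0 <= M by apply: le_trans (HM 0 _); rewrite ?lexx ?ler01.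
have c_gt0 : 0 < `|c| / (M + 1) by rewrite divr_gt0 ?normr_gt0 // ltr_wpDl.
apply: small_imp (small_and (small_lt c_gt0) (small_lt ltr01)) => e e_gt0 [ec e1].
rewrite hornerD hornerM hornerX hornerC addr_eq0; apply/negP => /eqP E.
have : `|c| <= M * e.
  rewrite -[c]opprK -E normrN normrM (gtr0_norm e_gt0) ler_pM2r //.
  by apply: HM; rewrite !ltW.
rewrite leNgt => /negP; apply; move: ec; rewrite ltr_pdivlMr ?ltr_wpDl //.
by rewrite mulrDr mulr1 mulrC => H; apply: lt_trans H; rewrite ltrDl.
Qed.

Lemma small_sep (x a : R) :
  small (fun e => (x < a -> x < a - 4 * e) /\ (a < x -> a + 4 * e < x)).
Proof.
case: (ltgtP x a) => xa.
- have d_gt0 : 0 < (a - x) / 4 by order_lra.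
  by apply: small_imp (small_lt d_gt0) => e e_gt0 ?; split=> //; order_lra.
- have d_gt0 : 0 < (x - a) / 4 by order_lra.
  by apply: small_imp (small_lt d_gt0) => e e_gt0 ?; split=> // _; order_lra.
- by apply: small_true.
Qed.

End Small.

(** * Moving a square off some of the points on its boundary *)

Section Generic.

Variable R : realFieldType.
Implicit Types (P : seq (R * R)) (K : R * R * R).

(** The third clause prevents a square from having points of [P] on all four sides: both differences
    would equal the side length. *)
Definition generic P : Prop :=
  [/\ {in P &, injective fst}, {in P &, injective snd} &
      forall p q u v, p \in P -> q \in P -> u \in P -> v \in P ->
        p != q -> u != v -> p.1 - q.1 != u.2 - v.2].

(** The margin [4 * e] exceeds every later displacement of a side relative to a point, which is at
    most [2 * e]. *)
Definition apart K (e : R) (p : R * R) : Prop :=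
  [/\ (p.1 < K.1.1 -> p.1 < K.1.1 - 4 * e) /\ (K.1.1 < p.1 -> K.1.1 + 4 * e < p.1),
      (p.1 < K.1.1 + K.2 -> p.1 < K.1.1 + K.2 - 4 * e) /\
        (K.1.1 + K.2 < p.1 -> K.1.1 + K.2 + 4 * e < p.1),
      (p.2 < K.1.2 -> p.2 < K.1.2 - 4 * e) /\ (K.1.2 < p.2 -> K.1.2 + 4 * e < p.2) &
      (p.2 < K.1.2 + K.2 -> p.2 < K.1.2 + K.2 - 4 * e) /\
        (K.1.2 + K.2 < p.2 -> K.1.2 + K.2 + 4 * e < p.2)].

Lemma small_apart P K : small (fun e => forall p, p \in P -> apart K e p).
Proof.
apply: small_all => p _.
apply: small_imp (small_and (small_and (small_sep p.1 K.1.1) (small_sep p.1 (K.1.1 + K.2)))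
  (small_and (small_sep p.2 K.1.2) (small_sep p.2 (K.1.2 + K.2)))) => e _ [[? ?] [? ?]].
by split.
Qed.

(** [L1] and [R1] say which sides must move strictly inwards, [L0] and [R0] which must not; [dl] and
    [dr] are the inward displacements. Their prescribed sum makes the horizontal and vertical
    directions shrink equally. *)
Lemma adjust_side (L1 R1 L0 R0 shrink : bool) (e : R) : 0 < e ->
  ~~ (L1 && L0) -> ~~ (R1 && R0) -> ~~ (if shrink then L0 && R0 else L1 && R1) ->
  exists dl dr, [/\ dl + dr = (if shrink then 2 * e else 0),
    - (2 * e) <= dl <= 2 * e, - (2 * e) <= dr <= 2 * e,
    (L1 -> 0 < dl) /\ (R1 -> 0 < dr) & (L0 -> dl <= 0) /\ (R0 -> dr <= 0)].
Proof.
move=> e0; case: shrink; case: L1; case: R1; case: L0; case: R0 => //= _ _ _;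
  first [ exists e, e; by split=> //; try (apply/andP; split); try split; order_lra
        | exists (2 * e), 0; by split=> //; try (apply/andP; split); try split; order_lra
        | exists 0, (2 * e); by split=> //; try (apply/andP; split); try split; order_lra
        | exists e, (- e); by split=> //; try (apply/andP; split); try split; order_lra
        | exists (- e), e; by split=> //; try (apply/andP; split); try split; order_lra
        | exists 0, 0; by split=> //; try (apply/andP; split); try split; order_lra].
Qed.

(* Sides carrying a point of [S] are pushed inwards, and the opposite side follows
   unless it carries one too; then the height must shrink as well, and general
   position ensures that one of the other two sides is free to move. *)
Lemma shrink_sq P (S : pred (R * R)) K : generic P -> 0 < K.2 ->
  (forall s, s \in P -> S s -> ~~ in_int K s) ->
  exists2 K', 0 < K'.2 & forall p, p \in P -> in_sq K' p = in_sq K p && ~~ S p.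
Proof.
move: K => [[a b] h] [gx gy gxy] /= h_gt0 noS.
have h3_gt0 : 0 < h / 3 by rewrite divr_gt0.
have [e e_gt0 [Hap he]] := small_ex (small_and (small_apart P ((a, b), h)) (small_lt h3_gt0)).
pose side (x : R * R -> R) v c := has (fun p => [&& in_sq (a, b, h) p, x p == v & S p == c]) P.
have sideP x v c : side x v c ->
    exists p, [/\ p \in P, in_sq (a, b, h) p, x p = v & S p = c].
  by move=> /hasP[p pP /and3P[? /eqP ? /eqP ?]]; exists p.
have side_in x v c p : p \in P -> in_sq (a, b, h) p -> x p = v -> S p = c -> side x v c.
  by move=> pP pK pv pc; apply/hasP; exists p => //; rewrite pK pv pc !eqxx.
have one (x : R * R -> R) v : {in P &, injective x} -> ~~ (side x v true && side x v false).
  move=> xinj; apply/negP=> /andP[/sideP[p [pP _ pv pS]] /sideP[q [qP _ qv qS]]].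
  by have pq : p = q by [apply: xinj; rewrite ?pv ?qv]; rewrite pq qS in pS.
pose shrink := (side fst a true && side fst (a + h) true) ||
               (side snd b true && side snd (b + h) true).
have cross : ~~ [&& side fst a true, side fst (a + h) true, side snd b false & side snd (b + h) false].
  apply/negP=> /and4P[/sideP[p [pP _ pv _]] /sideP[q [qP _ qv _]] /sideP[u [uP _ uv _]] /sideP[v [vP _ vv _]]].
  have := gxy q p v u qP pP vP uP; rewrite pv qv uv vv ![_ + h - _]addrAC !subrr !add0r eqxx.
  have -> : q != p by apply/eqP => E; move: qv; rewrite E pv; order_lra.
  have -> : v != u by apply/eqP => E; move: vv; rewrite E uv; order_lra.
  by move=> /(_ isT isT).
have cross' : ~~ [&& side snd b true, side snd (b + h) true, side fst a false & side fst (a + h) false].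
  apply/negP=> /and4P[/sideP[p [pP _ pv _]] /sideP[q [qP _ qv _]] /sideP[u [uP _ uv _]] /sideP[v [vP _ vv _]]].
  have := gxy v u q p vP uP qP pP; rewrite pv qv uv vv ![_ + h - _]addrAC !subrr !add0r eqxx.
  have -> : q != p by apply/eqP => E; move: qv; rewrite E pv; order_lra.
  have -> : v != u by apply/eqP => E; move: vv; rewrite E uv; order_lra.
  by move=> /(_ isT isT).
have [dl [dr [dlr dl_e dr_e [dl1 dr1] [dl0 dr0]]]] : exists dl dr,
    [/\ dl + dr = (if shrink then 2 * e else 0),
    - (2 * e) <= dl <= 2 * e, - (2 * e) <= dr <= 2 * e,
    (side fst a true -> 0 < dl) /\ (side fst (a + h) true -> 0 < dr)
    & (side fst a false -> dl <= 0) /\ (side fst (a + h) false -> dr <= 0)].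
  apply: adjust_side; rewrite ?one //.
  (* When the square shrinks, the left and right sides do not both carry points outside [S]: by
     [one] if these two sides forced the shrinking, by [cross'] if the other two did. *)
  move: (one fst a gx) (one fst (a + h) gx) cross cross'; rewrite /shrink.
  by do 8!case: (side _ _ _).
have [db [dt [dbt db_e dt_e [db1 dt1] [db0 dt0]]]] : exists db dt,
    [/\ db + dt = (if shrink then 2 * e else 0),
    - (2 * e) <= db <= 2 * e, - (2 * e) <= dt <= 2 * e,
    (side snd b true -> 0 < db) /\ (side snd (b + h) true -> 0 < dt)
    & (side snd b false -> db <= 0) /\ (side snd (b + h) false -> dt <= 0)].
  apply: adjust_side; rewrite ?one //.
  move: (one snd b gy) (one snd (b + h) gy) cross cross'; rewrite /shrink.
  by do 8!case: (side _ _ _).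
have s_le : dl + dr < h by rewrite dlr; case: (shrink); order_lra.
exists (a + dl, b + db, h - (dl + dr)); first by rewrite /= subr_gt0.
move=> p pP; have [/= [p1 p1'] [p2 p2'] [p3 p3'] [p4 p4']] := Hap p pP.
have E2 : b + db + (h - (dl + dr)) = b + h - dt by rewrite dlr -dbt; order_lra.
have E1 : a + dl + (h - (dl + dr)) = a + h - dr by order_lra.
move/andP: dl_e => [dl_e dl_e']; move/andP: dr_e => [dr_e dr_e'].
move/andP: db_e => [db_e db_e']; move/andP: dt_e => [dt_e dt_e'].
apply/idP/idP.
- rewrite {1}/in_sq /= E1 E2 => /and4P[q1 q2 q3 q4].
  have pK : in_sq (a, b, h) p.
    rewrite /in_sq /=; apply/and4P; split; rewrite leNgt; apply/negP.
    + by move=> /p1 ?; order_lra.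
    + by move=> /p2' ?; order_lra.
    + by move=> /p3 ?; order_lra.
    + by move=> /p4' ?; order_lra.
  rewrite pK /=; apply/negP => pS.
  have := noS p pP pS; rewrite /in_int /= !lt_neqAle; move: (pK) => /and4P[/= -> -> -> ->].
  rewrite !andbT => /negP; apply; apply/and4P; split; apply/eqP => E.
  + by have := dl1 (side_in fst a true p pP pK (esym E) pS); order_lra.
  + by have := dr1 (side_in fst (a + h) true p pP pK E pS); order_lra.
  + by have := db1 (side_in snd b true p pP pK (esym E) pS); order_lra.
  + by have := dt1 (side_in snd (b + h) true p pP pK E pS); order_lra.
- move=> /andP[pK /negbTE pS]; rewrite /in_sq /= E1 E2.
  move: (pK) => /and4P[/= q1 q2 q3 q4]; apply/and4P; split.
  + move: q1; rewrite le_eqVlt => /orP[/eqP E|/p1' ?]; last order_lra.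
    by have := dl0 (side_in fst a false p pP pK (esym E) pS); order_lra.
  + move: q2; rewrite le_eqVlt => /orP[/eqP E|/p2 ?]; last order_lra.
    by have := dr0 (side_in fst (a + h) false p pP pK E pS); order_lra.
  + move: q3; rewrite le_eqVlt => /orP[/eqP E|/p3' ?]; last order_lra.
    by have := db0 (side_in snd b false p pP pK (esym E) pS); order_lra.
  + move: q4; rewrite le_eqVlt => /orP[/eqP E|/p4 ?]; last order_lra.
    by have := dt0 (side_in snd (b + h) false p pP pK E pS); order_lra.
Qed.

End Generic.

(** * From two colours to powers of two, in general position *)

Section Colour.

Variable R : realFieldType.
Implicit Types (P : seq (R * R)) (K : R * R * R).

Lemma count_cover (T S : eqType) (f : S -> pred T) (a : pred T) (outs : seq S) (s : seq T) n :
  (forall x, x \in s -> a x -> exists2 o, o \in outs & f o x) ->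
  (forall o, o \in outs -> (count (f o) s <= n)%N) ->
  (count a s <= size outs * n)%N.
Proof.
elim: outs a => [|o outs IH] a cov fn.
  rewrite leqn0 -leqn0 leqNgt -has_count; apply/hasPn => x xs; apply/negP => /cov-/(_ xs).
  by case.
have on := fn o (mem_head _ _).
have {}IH := IH (fun x => a x && ~~ f o x).
rewrite /= mulSn; apply: leq_trans (leq_add on (IH _ _)).
- rewrite -(count_predUI (f o)) (leq_trans _ (leq_addr _ _)) //.
  by apply: sub_count => x /= ->; case: (f o x).
- move=> x xs /andP[/(cov x xs)[u + fx] nfx].
  rewrite inE => /orP[/eqP uE|uo]; last by exists u.
  by rewrite -uE fx in nfx.
- by move=> u uo; apply: fn; rewrite inE uo orbT.
Qed.

Lemma count_split (T : Type) (a b : pred T) (s : seq T) :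
  count a s = (count (predI a b) s + count (predI a (predC b)) s)%N.
Proof. by elim: s => //= x s ->; case: (a x); case: (b x) => /=; lia. Qed.

(** With [r < M] red points in [K], at most [2r + 2] squares cover [K], each with at most [m]
    non-red points. In total [K] has at most [(2r + 2)m + r] points, less than [2(m + 1)(r + 1)].
    The hypothesis concerns only the class [red], so it applies to either colour. *)
Lemma many_red m P (red : pred (R * R)) : generic P -> uniq P ->
  (forall K, 0 < K.2 -> (m.+1 <= count (in_sq K) P)%N -> has (predI (in_sq K) red) P) ->
  forall M K, 0 < K.2 -> (2 * m.+1 * M <= count (in_sq K) P)%N ->
  (M <= count (predI (in_sq K) red) P)%N.
Proof.
move=> gP unP Hred M K K_gt0 HK; rewrite leqNgt; apply/negP => rM.
have [gx gy _] := gP.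
have [e e_gt0 Hap] := small_ex (small_apart P K).
pose S := filter (predI (in_sq K) red) P.
have inK p : p \in P -> in_sq (K.1.1 - e, K.1.2 - e, K.2 + 2 * e) p = in_sq K p.
  move=> pP; have [[? ?] [? ?] [? ?] [? ?]] := Hap p pP.
  apply/idP/idP => /and4P[/= q1 q2 q3 q4]; apply/and4P; split=> /=; try order_lra;
    rewrite leNgt; apply/negP; lra.
have SP s : s \in S -> s \in P by rewrite mem_filter => /andP[].
(* Enlarging [K] by [e] puts its red points strictly inside and its left side within the range of
   the cover; by [inK] no point of [P] is gained. *)
have [|||||outs [sz gd co]] := @square_cover R (K.1.1 - e) (K.1.1 + K.2 + e) (K.1.2 - e) (K.1.2 + K.2 + e) S.
- by order_lra.
- by order_lra.
- move=> s; rewrite mem_filter => /andP[/andP[/and4P[s1 s2 s3 s4] _] _]; split; order_lra.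
- by move=> s t /SP sP /SP tP; apply: gx.
- exact: filter_uniq.
have : (count (predI (in_sq K) (predC red)) P <= size outs * m)%N.
  have [f Hf] : exists f : R * R * R -> R * R * R, forall Ko, Ko \in outs -> 0 < (f Ko).2 /\
     forall p, p \in P -> in_sq (f Ko) p = in_sq Ko p && (p \notin S).
    elim: outs gd {sz co} => [|Ko outs IH] gd; first by exists id.
    have [f Hf] : exists f : R * R * R -> R * R * R, forall Ko, Ko \in outs -> 0 < (f Ko).2 /\
        forall p, p \in P -> in_sq (f Ko) p = in_sq Ko p && (p \notin S).
      by apply: IH => K' K'o; apply: gd; rewrite inE K'o orbT.
    have [Ko_gt0 _ _ noS] := gd Ko (mem_head _ _).
    have [K' K'_gt0 HK'] := @shrink_sq _ P (mem S) Ko gP Ko_gt0 (fun s _ => noS s).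
    exists (fun K0 => if K0 == Ko then K' else f K0) => K0; rewrite inE.
    by case: eqP => [-> _|_ /Hf //]; split.
  apply: (@count_cover _ _ (fun Ko => in_sq (f Ko))) => [p pP /andP[pK pred]|Ko Koo].
    have /hasP[Ko Koo pKo] : covered outs p by move: pK => /and4P[*]; apply: co; order_lra.
    exists Ko => //; have [_ ->] := Hf Ko Koo; rewrite // pKo mem_filter.
    by rewrite /= (negbTE pred) andbF.
  (* A shrunken square with more than [m] points would contain a red point. That point is in [K] by
     [inK], hence in [S], which shrinking has removed. *)
  have [fKo_gt0 HKo] := Hf Ko Koo; rewrite leqNgt; apply/negP => /(Hred _ fKo_gt0)/hasP[p pP].
  rewrite /= HKo // => /andP[/andP[pKo pS] pred].
  move: pS; rewrite mem_filter /= pred pP !andbT -inK // => /negP; apply.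
  have [_ [? ?] [? ?] _] := gd Ko Koo; move: pKo => /and4P[*].
  by apply/and4P; split=> /=; order_lra.
have := count_split (in_sq K) red P.
have sS : size S = count (predI (in_sq K) red) P by rewrite size_filter.
move=> E bl; move: rM HK sz bl; rewrite E -sS; clear.
move: (size S) (size outs) (count _ P) => r k b rM HK sz bl.
have := leq_mul sz (leqnn m); have := leq_mul rM (leqnn m.*2).
by nia.
Qed.

Definition two_colourable m : Prop := forall P, uniq P -> exists red : pred (R * R),
  forall K, 0 < K.2 -> (m <= count (in_sq K) P)%N ->
    has (predI (in_sq K) red) P /\ has (predI (in_sq K) (predC red)) P.

Lemma generic_filter a P : generic P -> generic (filter a P).
Proof.
move=> [gx gy gxy]; split.
- by move=> p q; rewrite !mem_filter => /andP[_ ?] /andP[_ ?]; apply: gx.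
- by move=> p q; rewrite !mem_filter => /andP[_ ?] /andP[_ ?]; apply: gy.
- move=> p q u v; rewrite !mem_filter => /andP[_ ?] /andP[_ ?] /andP[_ ?] /andP[_ ?].
  exact: gxy.
Qed.

(** The lowest bit of a colour is the class in the two-colouring; the other bits come from a
    colouring of that class, in which [many_red] leaves enough points. *)
Lemma generic_colouring m t P : two_colourable m.+1 -> generic P -> uniq P ->
  exists c : R * R -> nat, forall K, 0 < K.2 ->
    (m.+1 * (2 * m.+1) ^ t <= count (in_sq K) P)%N ->
    forall i, (i < 2 ^ t.+1)%N -> has (fun p => in_sq K p && (c p == i)) P.
Proof.
move=> two; elim: t P => [|t IH] P gP unP; have [red Hred] := two P unP.
  exists (fun p => ~~ red p : nat) => K K_gt0; rewrite muln1 => /(Hred K K_gt0)[H1 H2] i i2.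
  case: i i2 => [|[|i]] // _; [apply: sub_has H1|apply: sub_has H2] => p /andP[/= -> /=].
    by move=> ->.
  by case: (red p).
have [c1 Hc1] := IH (filter red P) (generic_filter red gP) (filter_uniq _ unP).
have [c2 Hc2] := IH (filter (predC red) P) (generic_filter _ gP) (filter_uniq _ unP).
exists (fun p => if red p then (c1 p).*2 else (c2 p).*2.+1) => K K_gt0 HK i i2.
have HK' : (2 * m.+1 * (m.+1 * (2 * m.+1) ^ t) <= count (in_sq K) P)%N.
  by apply: leq_trans HK; rewrite expnS mulnCA.
have i2' : (i./2 < 2 ^ t.+1)%N by move: i2; rewrite expnS; lia.
have := odd_double_half i; case: (odd i) => /= iE.
- have : (m.+1 * (2 * m.+1) ^ t <= count (in_sq K) (filter (predC red) P))%N.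
    rewrite count_filter; apply: many_red HK' => // K' K'_gt0 /(Hred K' K'_gt0)[] //.
  move=> /(Hc2 K K_gt0)/(_ _ i2')/hasP[p]; rewrite mem_filter => /andP[/= pr pP] /andP[pK /eqP cp].
  by apply/hasP; exists p => //; rewrite pK (negbTE pr) cp; apply/eqP; rewrite -[RHS]iE.
- have : (m.+1 * (2 * m.+1) ^ t <= count (in_sq K) (filter red P))%N.
    rewrite count_filter; apply: many_red HK' => // K' K'_gt0 /(Hred K' K'_gt0)[] //.
  move=> /(Hc1 K K_gt0)/(_ _ i2')/hasP[p]; rewrite mem_filter => /andP[/= pr pP] /andP[pK /eqP cp].
  by apply/hasP; exists p => //; rewrite pK pr cp; apply/eqP; rewrite -[RHS]iE.
Qed.

End Colour.

(** * Perturbation to general position and open squares *)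

Section Perturbation.

Variable R : realFieldType.
Implicit Types (P : seq (R * R)) (K : R * R * R).

(** All coordinates of the points of [P] receive different powers of [e], so each coincidence
    forbidden by [generic] is the vanishing of a nonzero polynomial in [e]. *)
Definition perturb P (e : R) (p : R * R) : R * R :=
  (p.1 + e ^+ (index p P).*2.+1, p.2 + e ^+ (index p P).*2.+2).

Lemma small_coef (q : {poly R}) k : q`_k != 0 -> small (fun e => q.[e] != 0).
Proof.
by move=> qk; apply: small_poly; apply: contraNneq qk => ->; rewrite coef0.
Qed.

Lemma small_generic P : small (fun e => forall p, p \in P -> forall q, q \in P ->
  [/\ p != q -> (perturb P e p).1 != (perturb P e q).1,
      p != q -> (perturb P e p).2 != (perturb P e q).2 &
      forall u, u \in P -> forall v, v \in P -> p != q -> u != v ->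
        (perturb P e p).1 - (perturb P e q).1 != (perturb P e u).2 - (perturb P e v).2]).
Proof.
apply: small_all => p pP; apply: small_all => q qP.
have [<-|pq] := eqVneq p q; first by apply: small_true => e; split.
have ij : (index p P == index q P) = false.
  by apply/eqP => ij; move/negP: pq; apply; rewrite -(nth_index p pP) ij nth_index.
have H1 : small (fun e => (perturb P e p).1 != (perturb P e q).1).
  pose g := 'X^((index p P).*2.+1) - 'X^((index q P).*2.+1) + (p.1 - q.1)%:P : {poly R}.
  have Hg : g`_(index p P).*2.+1 != 0.
    rewrite !(coefD, coefN, coefXn, coefC) eqxx eqSS addr0.
    by rewrite (inj_eq double_inj) ij subr0 oner_eq0.
  apply: small_imp (small_coef Hg) => e _.
  rewrite !(hornerD, hornerN, hornerXn, hornerC) /perturb /=.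
  by apply: contraNneq => E; apply/eqP; order_lra.
have H2 : small (fun e => (perturb P e p).2 != (perturb P e q).2).
  pose g := 'X^((index p P).*2.+2) - 'X^((index q P).*2.+2) + (p.2 - q.2)%:P : {poly R}.
  have Hg : g`_(index p P).*2.+2 != 0.
    rewrite !(coefD, coefN, coefXn, coefC) eqxx !eqSS addr0.
    by rewrite (inj_eq double_inj) ij subr0 oner_eq0.
  apply: small_imp (small_coef Hg) => e _.
  rewrite !(hornerD, hornerN, hornerXn, hornerC) /perturb /=.
  by apply: contraNneq => E; apply/eqP; order_lra.
have H3 : small (fun e => forall u, u \in P -> forall v, v \in P ->
    (perturb P e p).1 - (perturb P e q).1 != (perturb P e u).2 - (perturb P e v).2).
  apply: small_all => u uP; apply: small_all => v vP.
  pose g := 'X^((index p P).*2.+1) - 'X^((index q P).*2.+1)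
     - ('X^((index u P).*2.+2) - 'X^((index v P).*2.+2)) + (p.1 - q.1 - (u.2 - v.2))%:P : {poly R}.
  have Hg : g`_(index p P).*2.+1 != 0.
    (* Abscissas use odd exponents and ordinates even ones, so nothing cancels the power belonging
       to [p]. *)
    have odd_even n l : (n.*2 == l.*2.+1) = false by apply/eqP; lia.
    rewrite !(coefD, coefN, coefXn, coefC) eqxx !eqSS ![_.*2 == _.*2.+1]odd_even.
    by rewrite (inj_eq double_inj) ij !(subr0, addr0) oner_eq0.
  apply: small_imp (small_coef Hg) => e _.
  rewrite !(hornerD, hornerN, hornerXn, hornerC) /perturb /=.
  by apply: contraNneq => E; apply/eqP; order_lra.
apply: small_imp (small_and H1 (small_and H2 H3)) => e _ [h1 [h2 h3]].
by split=> // u uP v vP _ _; apply: h3.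
Qed.

(** Coordinates move by less than [d]. Enlarging [K] by [d] therefore keeps its points, while the
    others start more than [4 * d] beyond some side. *)
Lemma small_trace P K : 0 < K.2 -> small (fun e => exists2 K', 0 < K'.2 &
  forall p, p \in P -> in_sq K' (perturb P e p) = in_sq K p).
Proof.
move=> K_gt0; have [d d_gt0 Hap] := small_ex (small_apart P K).
apply: small_imp (small_and (small_lt d_gt0) (small_lt ltr01)) => e e_gt0 [ed e1].
exists (K.1.1 - d, K.1.2 - d, K.2 + 2 * d) => [|p pP] /=; first order_lra.
have [[? ?] [? ?] [? ?] [? ?]] := Hap p pP.
have pow n : 0 < e ^+ n.+1 /\ e ^+ n.+1 <= e.
  by rewrite exprn_gt0 // exprS ger_pMr // exprn_ile1 // ltW.
have [x0 x1] := pow (index p P).*2; have [y0 y1] := pow (index p P).*2.+1.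
apply/idP/idP => /and4P[/= q1 q2 q3 q4]; apply/and4P; split=> /=; try order_lra;
  rewrite leNgt; apply/negP; lra.
Qed.

(** One [e] must serve all squares. Only the trace of a square on [P] matters, and there are
    finitely many boolean tuples, so one representative [K0] per realized trace is enough. *)
Lemma generic_perturbation P : exists f : R * R -> R * R,
  [/\ {in P &, injective f}, generic (map f P)
    & forall K, 0 < K.2 -> exists2 K', 0 < K'.2 &
        forall p, p \in P -> in_sq K' (f p) = in_sq K p].
Proof.
have Htrace : small (fun e => forall bs, bs \in enum {: (size P).-tuple bool} ->
    forall K, 0 < K.2 -> map (in_sq K) P = bs -> exists2 K', 0 < K'.2 &
      forall p, p \in P -> in_sq K' (perturb P e p) = in_sq K p).
  apply: small_all => bs _.
  have [[K0 [K0_gt0 E0]]|noK] := EM (exists K, 0 < K.2 /\ map (in_sq K) P = bs).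
    apply: small_imp (small_trace P K0_gt0) => e _ [K' K'_gt0 HK'] K _ EK.
    exists K' => // p pP; rewrite HK' //.
    by have /eq_in_map H : map (in_sq K0) P = map (in_sq K) P by [rewrite E0 EK]; apply: H.
  by apply: small_true => e K K_gt0 EK; case: noK; exists K.
have [e e_gt0 [Hg Ht]] := small_ex (small_and (small_generic P) Htrace).
have injx : {in P &, injective (fst \o perturb P e)}.
  by move=> p q pP qP /eqP /= E; apply/eqP; apply: contraTT E; case: (Hg p pP q qP).
have injy : {in P &, injective (snd \o perturb P e)}.
  by move=> p q pP qP /eqP /= E; apply/eqP; apply: contraTT E; case: (Hg p pP q qP).
exists (perturb P e); split.
- by move=> p q pP qP E; apply: injx => //; exact: (congr1 fst E).
- split.
  + by move=> _ _ /mapP[p pP ->] /mapP[q qP ->] E; rewrite (injx p q pP qP E).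
  + by move=> _ _ /mapP[p pP ->] /mapP[q qP ->] E; rewrite (injy p q pP qP E).
  + move=> _ _ _ _ /mapP[p pP ->] /mapP[q qP ->] /mapP[u uP ->] /mapP[v vP ->] pq uv.
    have [_ _] := Hg p pP q qP; apply=> //.
      by apply: contraNneq pq => ->.
    by apply: contraNneq uv => ->.
- move=> K K_gt0.
  have sz : size (map (in_sq K) P) == size P by rewrite size_map.
  by apply: (Ht (Tuple sz)); rewrite ?mem_enum.
Qed.

(** Moving each side inwards by [e] drops the boundary points and keeps the interior ones, which are
    farther than [4 * e] from every side. *)
Lemma open_closed_trace P K : 0 < K.2 -> exists2 K', 0 < K'.2 &
  forall p, p \in P -> in_sq K' p = in_int K p.
Proof.
move=> K_gt0; have h4_gt0 : 0 < K.2 / 4 by order_lra.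
have [e e_gt0 [Hap he]] := small_ex (small_and (small_apart P K) (small_lt h4_gt0)).
exists (K.1.1 + e, K.1.2 + e, K.2 - 2 * e) => [|p pP] /=; first order_lra.
have [[? ?] [? ?] [? ?] [? ?]] := Hap p pP.
apply/idP/idP => /and4P[/= q1 q2 q3 q4]; apply/and4P; split=> /=; try order_lra;
  rewrite leNgt; apply/negP; lra.
Qed.

End Perturbation.

(** * Transfer to sets, finite sets of points and [k] colours *)

Lemma mem_closed_square (R : realType) (a b s : R) (p : R * R) :
  (p \in (`[a, a + s] `*` `[b, b + s])%classic) = in_sq (a, b, s) p.
Proof.
apply/idP/idP => [|/and4P[/= *]].
  by rewrite in_setE /= !in_itv /= => -[/andP[? ?] /andP[? ?]]; apply/and4P.
by rewrite in_setE /= !in_itv /=; split; apply/andP.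
Qed.

Lemma mem_open_square (R : realType) (a b s : R) (p : R * R) :
  (p \in (`]a, a + s[ `*` `]b, b + s[)%classic) = in_int (a, b, s) p.
Proof.
apply/idP/idP => [|/and4P[/= *]].
  by rewrite in_setE /= !in_itv /= => -[/andP[? ?] /andP[? ?]]; apply/and4P.
by rewrite in_setE /= !in_itv /=; split; apply/andP.
Qed.

Lemma card_fset_count (T : choiceType) (P : {fset T}) (a : pred T) :
  #|` [fset p in P | a p]%fset| = count a P.
Proof.
rewrite -size_filter; apply: perm_size; apply: uniq_perm; rewrite ?fset_uniq ?filter_uniq //.
by move=> p; rewrite !inE mem_filter andbC.
Qed.

Lemma two_colourable_of_closed (R : realType) m :
  (forall P : {fset R * R}, exists c : P -> 'I_2,
     polychromatic (@closed_square R) m%:R c) -> two_colourable R m.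
Proof.
move=> two P unP; pose F := [fset p in P]%fset.
have FP p : (p \in F) = (p \in P) by rewrite !inE.
have [c Hc] := two F.
pose red p := if insub p is Some q then c q == ord0 else false.
have redE (q : F) : red (fsval q) = (c q == ord0) by rewrite /red valK.
have cnt K : count (in_sq K) F = count (in_sq K) P.
  by apply/permP/uniq_perm; rewrite ?fset_uniq.
exists red => -[[a b] s] s_gt0 HP.
have HQ i : exists p : F, in_sq (a, b, s) (fsval p) /\ c p = i.
  have [||p [pQ cp]] := Hc (`[a, a + s] `*` `[b, b + s])%classic _ _ i.
  - by exists a, b, s.
  - rewrite card_fset_count ler_nat.
    by under eq_count => p do rewrite mem_closed_square; rewrite cnt.
  by exists p; rewrite -mem_closed_square.
split; apply/hasP.
- have [p [pQ cp]] := HQ ord0; exists (fsval p); first by rewrite -FP fsvalP.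
  by rewrite /= pQ redE cp.
- have [p [pQ cp]] := HQ ord_max; exists (fsval p); first by rewrite -FP fsvalP.
  by rewrite /= pQ redE cp.
Qed.

Unset Implicit Arguments.

Theorem corollary8 (R : realType) (m : nat) (m_gt0 : (0 < m)%N)
    (two_colors : forall P : {fset R * R}, exists c : P -> 'I_2,
        polychromatic (@closed_square R) m%:R c) :
  forall k : nat, (0 < k)%N ->
  forall P : {fset R * R}, exists c : P -> 'I_k,
    polychromatic (fun Q => open_square Q \/ closed_square Q)
      (m_bound R m k) c.
Proof.
move=> k k_gt0 P; have := @up_logP 2 k isT; rewrite /m_bound.
case: (up_log 2 k) => [|t] kt.
  have k1 : k = 1%N by apply/eqP; rewrite eqn_leq k_gt0 kt.
  move: k1 k_gt0 kt => -> _ _; exists (fun=> ord0) => Q _ hQ i.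
  have : (0 < #|` [fset p in P | p \in Q]%fset|)%N.
    rewrite -(ltr_nat R); apply: lt_le_trans hQ.
    by rewrite sub0r exprN1 divr_gt0 // ltr0n ?muln_gt0.
  rewrite cardfs_gt0 => /fset0Pn[p]; rewrite !inE => /andP[pP pQ].
  by exists (FSetSub pP); rewrite [i]ord1.
have -> : m%:R * (2 * m)%:R ^ (t.+1%:Z - 1) = (m * (2 * m) ^ t)%:R :> R.
  have -> : t.+1%:Z - 1 = t by lia.
  by rewrite [RHS]natrM natrX.
have two := two_colourable_of_closed two_colors.
have [f [finj fgen Hf]] := generic_perturbation (P : seq _).
have unf : uniq (map f P) by rewrite map_inj_in_uniq ?fset_uniq.
case: m m_gt0 two {two_colors} => // m _ two.
have [c Hc] := generic_colouring t two fgen unf.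
(* Colours from [k] to [2 ^ t.+1 - 1] are merged into colour 0; every colour below [k] still
   occurs. *)
exists (fun p => insubd (Ordinal k_gt0) (c (f (fsval p)))) => Q HQ hQ i.
have [K K_gt0 HK] : exists2 K : R * R * R, 0 < K.2 &
    forall p, p \in (P : seq _) -> in_sq K p = (p \in Q).
  case: HQ => -[a [b [s [s_gt0 ->]]]].
    have [K K_gt0 HK] := @open_closed_trace _ P (a, b, s) s_gt0.
    by exists K => // p pP; rewrite HK // mem_open_square.
  by exists (a, b, s) => // p _; rewrite mem_closed_square.
have [K' K'_gt0 HK'] := Hf K K_gt0.
have iK : (i < 2 ^ t.+1)%N by apply: leq_trans (ltn_ord i) kt.
have /(Hc K' K'_gt0)/(_ _ iK)/hasP[_ /mapP[p pP ->] /andP[pK /eqP cp]] :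
    (m.+1 * (2 * m.+1) ^ t <= count (in_sq K') (map f P))%N.
  move: hQ; rewrite card_fset_count ler_nat => /leq_trans; apply.
  rewrite count_map; apply: eq_leq; apply: eq_in_count => p pP /=.
  by rewrite HK' // HK.
exists (FSetSub pP); split; first by rewrite /= -HK // -HK'.
by apply: val_inj; rewrite val_insubd /= cp ltn_ord.
Qed.
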